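(* Let $N\ge 1$ be an integer and suppose that $V\in C^{2}(\mathbb{R}^{N},\mathbb{R})$ satisfies the following conditions: (V1) $\lim_{x\to 0}\frac{V(x)}{|x|^{2}}=0$; (V2) $\lim_{|x|\to\infty}\frac{V(x)}{|x|^{2}}=+\infty$; (V3) $0<V'(x)\cdot x\le V''(x)x\cdot x$ for all $x\in\mathbb{R}^{N}\setminus\{0\}$; (V4) $V(x)=V(-x)$ for all $x\in\mathbb{R}^N$. Then for every $T>0$ there is a $T$-periodic solution $x:\mathbb{R}\to\mathbb{R}^N$ of the second order Hamiltonian system $$\ddot{x}+V'(x)=0$$ with $T$ its minimal period, which is even about $t=0$ and $t=T/2$, and odd about $t=T/4$ and $t=3T/4$.
   Context: $V'$ denotes the gradient and $V''$ the Hessian matrix of $V$; $\cdot$ is the Euclidean inner product and $|\cdot|$ the Euclidean norm on $\mathbb{R}^N$. A function $x$ is even (resp. odd) about $t=t_0$ if $x(t_0+s)=x(t_0-s)$ (resp. $x(t_0+s)=-x(t_0-s)$) for all $s$. ''With $T$ its minimal period'' means that $T$ is the smallest positive period of $x$ (in particular $x$ is non-constant). *)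

(* Defs.v *)
From HB Require Import structures.
From mathcomp Require Import all_boot all_order all_algebra.
From mathcomp Require Import all_classical all_reals all_analysis.

Set Implicit Arguments.
Unset Strict Implicit.
Unset Printing Implicit Defensive.

Import Order.TTheory GRing.Theory Num.Theory.
Import numFieldNormedType.Exports.

Local Open Scope classical_set_scope.
Local Open Scope ring_scope.

(* Points of R^N are row vectors. The norm `|u| of the library on 'rV[R]_N is
   the sup norm; it induces the usual topology and the usual notion of
   differentiability, but the Euclidean norm is [enorm]. *)
Definition dotv (R : realType) (N : nat) (u v : 'rV[R]_N) : R :=
  \sum_(i < N) u 0 i * v 0 i.

Definition enorm (R : realType) (N : nat) (u : 'rV[R]_N) : R :=
  Num.sqrt (dotv u u).

(* ['D_v f x] is a total operator: the two definitions below are meaningful for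
   functions that are differentiable often enough, see [is_C2]. *)
Definition grad (R : realType) (N : nat) (V : 'rV[R]_N -> R) (x : 'rV[R]_N) :
    'rV[R]_N :=
  \row_(i < N) 'D_(delta_mx 0 i) V x.

Definition hessian (R : realType) (N : nat) (V : 'rV[R]_N -> R)
    (x : 'rV[R]_N) : 'M[R]_N :=
  \matrix_(i < N, j < N) 'D_(delta_mx 0 j) ('D_(delta_mx 0 i) V) x.

Definition is_C2 (R : realType) (N : nat) (V : 'rV[R]_N -> R) : Prop :=
  [/\ forall x, differentiable V x,
      forall x, differentiable (grad V) x
    & continuous (hessian V)].

(* The column vector H u, as a row vector. *)
Definition mxapp (R : realType) (N : nat) (H : 'M[R]_N) (u : 'rV[R]_N) :
    'rV[R]_N :=
  u *m H^T.

(* F(x) --> +oo as the Euclidean norm of x tends to infinity. *)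
Definition cvg_pinfty_at_infty (R : realType) (N : nat) (F : 'rV[R]_N -> R) :
    Prop :=
  forall A : R, exists M : R, forall x : 'rV[R]_N, M < enorm x -> A < F x.

Definition is_solution (R : realType) (N : nat) (V : 'rV[R]_N -> R)
    (x : R -> 'rV[R]_N) : Prop :=
  forall t : R, [/\ derivable x t 1, derivable (derive1 x) t 1
                  & derive1 (derive1 x) t + grad V (x t) = 0].

Definition minimal_period (R : realType) (N : nat) (x : R -> 'rV[R]_N) (T : R) :
    Prop :=
  [/\ 0 < T, periodic x T & forall S : R, 0 < S -> periodic x S -> T <= S].

Definition even_about (R : realType) (N : nat) (x : R -> 'rV[R]_N) (t0 : R) :
    Prop :=
  forall s : R, x (t0 + s) = x (t0 - s).

Definition odd_about (R : realType) (N : nat) (x : R -> 'rV[R]_N) (t0 : R) :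
    Prop :=
  forall s : R, x (t0 + s) = - x (t0 - s).

(* Main.v *)
(** Put tau = T / 4. By the symmetries it suffices to solve x'' + V'(x) = 0 on
    [0, tau] with x'(0) = 0, x(tau) = 0 and x <> 0 on [0, tau); evenness about
    0 and oddness about tau then extend x to a T-periodic solution whose zeros
    are exactly tau + 2 tau Z, so that T is its minimal period.

    Such an x is a ground state. Let c0 be the infimum over x of the maximum of
    the action I(s x), s >= 0. Restricted to the ball int |x'|^2 <= 1, which is
    compact for uniform convergence, the functional to be minimized is lower
    semicontinuous, so c0 is attained. As (V3) is not strict, the maximum on the
    ray through the minimizer may be reached on a whole segment; deforming the
    ray along the gradient x - K V'(x) of I (K is the Green operator) and
    intersecting it with the Nehari set yields one s for which s x is critical.
    If this solution had a zero a in [0, tau), its truncation to [0, a] would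
    also be a minimizer up to scaling, hence proportional to a solution which
    vanishes on [a, tau], against conservation of energy. *)

Require Import Defs.
From HB Require Import structures.
From mathcomp Require Import all_boot all_order all_algebra.
From mathcomp Require Import all_classical all_reals all_analysis.
From mathcomp Require Import ring lra zify.

Set Implicit Arguments.
Unset Strict Implicit.
Unset Printing Implicit Defensive.

Import Order.TTheory GRing.Theory Num.Theory.
Import numFieldNormedType.Exports.

Local Open Scope classical_set_scope.
Local Open Scope ring_scope.

(** * Continuous functions and their integrals *)

(** All functions are continuous and the kinetic energy is never a number: [energy_le tau x e]
    bounds it from above. Upper bounds suffice, because the action is only ever estimated from
    above, its lower bound being the definition of c0. With the bound normalized to 1, the action at
    the point s of a ray is at most s^2 / 2 - int V(s x), so only the potential term has to pass to
    the limit. Since (V3) is not strict, the radial derivative of the Nehari functional may vanish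
    at the minimizer, which blocks the usual Lagrange multiplier argument. Instead a whole range d
    <= s <= S of the ray is moved by a small e > 0 along the gradient. The Nehari functional is
    positive at d and negative at S, and stays so for small e, so the moved ray still crosses the
    Nehari set, at a parameter r depending on e. Minimality at the crossing bounds the squared norm
    D r of the gradient by C e. Letting e tend to 0, the minimum of D over [d, S] is 0, and the
    gradient vanishes where it is attained. *)

Lemma cont_pair (A B C : topologicalType) (f : A -> B) (g : A -> C) :
  continuous f -> continuous g -> continuous (fun x => (f x, g x)).
Proof. by move=> cf cg x; exact: (cvg_pair (cf x) (cg x)). Qed.

Lemma cont_comp (A B C : topologicalType) (f : A -> B) (g : B -> C) :
  continuous f -> continuous g -> continuous (fun x => g (f x)).
Proof. by move=> cf cg x; exact: (continuous_comp (cf x) (cg _)). Qed.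

Lemma cont_cst (A B : topologicalType) (b : B) : continuous (fun _ : A => b).
Proof. move=> x; exact: cvg_cst. Qed.

Lemma cont_id (A : topologicalType) : continuous (fun x : A => x).
Proof. move=> x; exact: cvg_id. Qed.

Lemma cont_fst (A B : topologicalType) : continuous (@fst A B).
Proof. move=> x; exact: cvg_fst. Qed.

Lemma cont_snd (A B : topologicalType) : continuous (@snd A B).
Proof. move=> x; exact: cvg_snd. Qed.

Arguments cont_cst {A B} b.
Arguments cont_id {A}.
Arguments cont_fst {A B}.
Arguments cont_snd {A B}.

Lemma cont_D (R : numFieldType) (A : topologicalType) (V : normedModType R) (f g : A -> V) :
  continuous f -> continuous g -> continuous (fun x => f x + g x).
Proof. by move=> cf cg x; exact: (cvgD (cf x) (cg x)). Qed.

Lemma cont_B (R : numFieldType) (A : topologicalType) (V : normedModType R) (f g : A -> V) :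
  continuous f -> continuous g -> continuous (fun x => f x - g x).
Proof. by move=> cf cg x; exact: (cvgB (cf x) (cg x)). Qed.

Lemma cont_N (R : numFieldType) (A : topologicalType) (V : normedModType R) (f : A -> V) :
  continuous f -> continuous (fun x => - f x).
Proof. by move=> cf x; exact: (cvgN (cf x)). Qed.

Lemma cont_M (R : numFieldType) (A : topologicalType) (f g : A -> R) :
  continuous f -> continuous g -> continuous (fun x => f x * g x).
Proof. by move=> cf cg x; exact: (cvgM (cf x) (cg x)). Qed.

Lemma cont_Z (R : numFieldType) (A : topologicalType) (V : normedModType R) (k : A ->
  R) (f : A -> V) :
  continuous k -> continuous f -> continuous (fun x => k x *: f x).
Proof. by move=> cf cg x; exact: (cvgZ (cf x) (cg x)). Qed.

Lemma is_derive_cont (R : realType) (F f : R -> R) :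
  (forall t : R, is_derive t 1 F (f t)) -> continuous F.
Proof.
move=> dF t; apply: differentiable_continuous; apply/derivable1_diffP.
exact: ex_derive.
Qed.

Lemma is_derive_MVT (R : realType) (F f : R -> R) (a b : R) : a <= b ->
  (forall t : R, a <= t <= b -> is_derive t 1 F (f t)) ->
  exists2 c, a <= c <= b & F b - F a = f c * (b - a).
Proof.
move=> ab dF.
have [|| c] := @MVT_segment R F f a b ab.
- by move=> t; rewrite in_itv/= => /andP[? ?]; apply: dF; rewrite !ltW.
- apply: derivable_within_continuous => t; rewrite in_itv/= => tab.
  by apply: ex_derive; exact: dF.
- by rewrite in_itv/= => cab E; exists c.
Qed.

Lemma is_derive_ge0 (R : realType) (F f : R -> R) (a b : R) : a <= b ->
  (forall t : R, a <= t <= b -> is_derive t 1 F (f t)) ->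
  (forall t, a <= t <= b -> 0 <= f t) -> F a <= F b.
Proof.
move=> ab dF f0; have [c cab E] := is_derive_MVT ab dF.
by rewrite -subr_ge0 E mulr_ge0 ?f0 ?subr_ge0.
Qed.

Lemma is_derive_eq0 (R : realType) (F f : R -> R) (a b : R) : a <= b ->
  (forall t : R, a <= t <= b -> is_derive t 1 F (f t)) ->
  (forall t, a <= t <= b -> f t = 0) -> F b = F a.
Proof.
move=> ab dF f0; have [c cab E] := is_derive_MVT ab dF.
by apply/eqP; rewrite -subr_eq0 E f0 // mul0r.
Qed.

Lemma is_derive_inj (R : realType) (F G f : R -> R) (a : R) :
  (forall t : R, is_derive t 1 F (f t)) -> (forall t : R, is_derive t 1 G (f t)) ->
  F a = G a -> F = G.
Proof.
move=> dF dG FGa; apply/funext => t; apply/eqP; rewrite -subr_eq0; apply/eqP.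
have d (s : R) : is_derive s 1 (F - G) 0.
  by apply: is_derive_eq; rewrite subrr.
have -> : 0 = (F - G) a by rewrite !fctE FGa subrr.
have -> : F t - G t = (F - G) t by [].
have [at_|/ltW ta] := leP a t.
  by apply: (is_derive_eq0 (f := fun=> 0) at_) => s _ //; exact: d.
by apply/esym; apply: (is_derive_eq0 (f := fun=> 0) ta) => s _ //; exact: d.
Qed.

Lemma is_derive_neg (R : realType) (F : R -> R) (df : R) (t : R) :
  is_derive (- t) 1 F df -> is_derive t 1 (fun u => F (- u)) (- df).
Proof.
move=> dF; have H : is_derive t 1 (F \o -%R) (df * - 1).
  exact: is_derive1_comp.
by apply: is_derive_eq H _; rewrite mulrN1.
Qed.

Lemma antiderivative_half (R : realType) (f : R -> R) :
  continuous f -> (forall t, t <= 0 -> f t = 0) ->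
  exists F : R -> R, forall t : R, is_derive t 1 F (f t).
Proof.
move=> cf f0.
exists (fun x => \int[lebesgue_measure]_(t in [set` `[-1, x]]) (f t))%R => t.
have [t0|t0] := ltP t 0.
  have -> : f t = 0 by rewrite f0 // ltW.
  apply: (@near_eq_is_derive _ _ _ (cst 0)) => //.
    near=> y; rewrite /cst /Rintegral (eq_integral (cst 0%E)).
      by rewrite integral0.
    move=> z; rewrite inE /= in_itv/= => /andP[_ zy]; rewrite f0 //.
    by rewrite (le_trans zy) // ltW //; near: y; exact: lt_nbhsl.
have : lebesgue_measure.-integrable `[(-1), (t + 1)] (EFin \o f).
  apply: continuous_compact_integrable; first exact: segment_compact.
  by apply: continuous_subspaceT.
move/(@continuous_FTC1_closed _ f (-1) t (t + 1)).
rewrite ltrDl ltr01 => /(_ isT).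
have t1 : -1 < t by rewrite (lt_le_trans _ t0) // ltrN10.
move=> /(_ t1 (cf t)) [d1 d2].
by apply: DeriveDef => //; rewrite -derive1E.
Unshelve. all: by end_near. Qed.

(* Cutting [f] at 0 reduces to integrands vanishing on a half-line, so that the
   integral over [-1, x] is an antiderivative on all of R. *)
Lemma antiderivative_ex (R : realType) (f : R -> R) : continuous f ->
  exists F : R -> R, forall t : R, is_derive t 1 F (f t).
Proof.
move=> cf.
have cmax : continuous (fun t : R => Num.max t 0).
  by move=> t; apply: (@continuous_max _ _ id (cst 0)); [exact: cvg_id|exact: cvg_cst].
have ccm : continuous (fun t : R => f (Num.max t 0) - f 0).
  move=> t; apply: cvgB; last exact: cvg_cst.
  exact: (continuous_comp (cmax t) (cf _)).
have ccn : continuous (fun t : R => f (- Num.max t 0) - f 0).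
  move=> t; apply: cvgB; last exact: cvg_cst.
  apply: (continuous_comp (f := fun t : R => - Num.max t 0) _ (cf _)).
  by apply: cvgN; exact: cmax.
have [|F dF] := antiderivative_half ccm.
  by move=> t t0; rewrite max_r // subrr.
have [|G dG] := antiderivative_half ccn.
  by move=> t t0; rewrite max_r // oppr0 subrr.
exists (F - (fun t => G (- t)) + f 0 *: id) => t.
have dGN := is_derive_neg (dG (- t)).
apply: is_derive_eq.
rewrite /GRing.scale /= mulr1; have [t0|t0] := leP 0 t.
  by rewrite max_r ?oppr_le0 // oppr0; ring.
by rewrite max_l ?oppr_ge0 ?opprK ?ltW //; ring.
Qed.

Definition antider (R : realType) (f : R -> R) : R -> R :=
  get (fun F : R -> R => forall t : R, is_derive t 1 F (f t)).

(** An oriented integral: being a difference of two values, it is additive over intervals for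
    endpoints in any order. When f has no antiderivative, [antider] is the default value of
    [get]. *)
Definition itg (R : realType) (a b : R) (f : R -> R) : R :=
  antider f b - antider f a.

Lemma antiderP (R : realType) (f : R -> R) (t : R) :
  continuous f -> is_derive t 1 (antider f) (f t).
Proof.
by move=> cf; move: t; exact: (getPex (antiderivative_ex cf)).
Qed.

Section itg.
Context {R : realType}.
Implicit Types f g F G : R -> R.

Lemma itg_derive (a t : R) f :
  continuous f -> is_derive t 1 (fun b => itg a b f) (f t).
Proof.
move=> cf; have dA := antiderP t cf.
rewrite (_ : (fun b => _) = antider f - cst (antider f a)) //.
by apply: is_derive_eq; rewrite subr0.
Qed.

Lemma itgE F f (a b : R) : (forall t : R, is_derive t 1 F (f t)) ->
  continuous f -> itg a b f = F b - F a.
Proof.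
move=> dF cf.
suff E : (fun b => itg a b f) = (fun b => F b - F a) by exact: (congr1 (@^~ b) E).
apply: (is_derive_inj (a := a)) => [t|t|].
- exact: itg_derive.
- rewrite (_ : (fun b => _) = F - cst (F a)) //.
  by have := dF t => ?; apply: is_derive_eq; rewrite subr0.
- by rewrite /itg !subrr.
Qed.

Lemma itg_cont (a : R) f : continuous f -> continuous (fun b => itg a b f).
Proof. by move=> cf; apply: is_derive_cont => t; exact: itg_derive. Qed.

Lemma itgxx (a : R) f : itg a a f = 0. Proof. exact: subrr. Qed.

Lemma itg_cat (b a c : R) f : itg a c f = itg a b f + itg b c f.
Proof. by rewrite /itg; ring. Qed.

Lemma itgD (a b : R) f g : continuous f -> continuous g ->
  itg a b (fun t => f t + g t) = itg a b f + itg a b g.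
Proof.
move=> cf cg.
have d (t : R) : is_derive t 1 (antider f + antider g) (f t + g t).
  by have df := antiderP t cf; have dg := antiderP t cg; exact: is_derive_eq.
rewrite (itgE _ _ d); first by rewrite !fctE /itg; ring.
by move=> t; apply: cvgD; [exact: cf|exact: cg].
Qed.

Lemma itgZ (a b k : R) f : continuous f ->
  itg a b (fun t => k * f t) = k * itg a b f.
Proof.
move=> cf.
have d (t : R) : is_derive t 1 (k *: antider f) (k * f t).
  by have df := antiderP t cf; exact: is_derive_eq.
rewrite (itgE _ _ d); first by rewrite !fctE /itg /GRing.scale /=; ring.
by move=> t; apply: cvgM; [exact: cvg_cst|exact: cf].
Qed.

Lemma itg_cst (a b k : R) : itg a b (fun=> k) = k * (b - a).
Proof.
have d (t : R) : is_derive t 1 (k *: @id R) k.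
  by apply: is_derive_eq; rewrite /GRing.scale /= mulr1.
rewrite (itgE _ _ d); first by rewrite !fctE /GRing.scale /=; ring.
by move=> t; exact: cvg_cst.
Qed.

Lemma itgN (a b : R) f : continuous f ->
  itg a b (fun t => - f t) = - itg a b f.
Proof.
move=> cf; rewrite -mulN1r -itgZ //.
by congr (itg a b _); apply/funext => t; rewrite mulN1r.
Qed.

Lemma itgB (a b : R) f g : continuous f -> continuous g ->
  itg a b (fun t => f t - g t) = itg a b f - itg a b g.
Proof.
move=> cf cg; rewrite itgD // ?itgN //.
by move=> t; apply: cvgN; exact: cg.
Qed.

Lemma itg_ge0 (a b : R) f : continuous f -> a <= b ->
  (forall t, a <= t <= b -> 0 <= f t) -> 0 <= itg a b f.
Proof.
move=> cf ab f0; rewrite -(itgxx a f).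
apply: (is_derive_ge0 (F := fun b => itg a b f) ab) f0 => t _.
exact: itg_derive.
Qed.

Lemma itg_le (a b : R) f g : continuous f -> continuous g -> a <= b ->
  (forall t, a <= t <= b -> f t <= g t) -> itg a b f <= itg a b g.
Proof.
move=> cf cg ab fg; rewrite -subr_ge0 -itgB //; apply: itg_ge0 => //.
  by move=> t; apply: cvgB; [exact: cg|exact: cf].
by move=> t tab; rewrite subr_ge0 fg.
Qed.

Lemma itg_eq (a b : R) f g : continuous f -> continuous g -> a <= b ->
  (forall t, a <= t <= b -> f t = g t) -> itg a b f = itg a b g.
Proof.
move=> cf cg ab fg; apply/eqP; rewrite eq_le; apply/andP; split;
  by apply: itg_le => // t tab; rewrite fg.
Qed.

Lemma itg_abs_le (a b k : R) f : continuous f -> a <= b ->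
  (forall t, a <= t <= b -> `|f t| <= k) -> `|itg a b f| <= k * (b - a).
Proof.
move=> cf ab fk; have ck (c : R) : continuous (fun _ : R => c) by move=> t; exact: cvg_cst.
rewrite ler_norml; apply/andP; split.
  rewrite -mulNr -itg_cst; apply: itg_le => // t /fk.
  by rewrite ler_norml => /andP[].
by rewrite -itg_cst; apply: itg_le => // t /fk; rewrite ler_norml => /andP[].
Qed.

(** The integral from a to s is squeezed between 0 and the total integral 0, so it is constant in s
    on the open interval, and its derivative f vanishes there. *)
Lemma itg_eq0_ge0 (a b : R) f : continuous f ->
  (forall t, a <= t <= b -> 0 <= f t) -> itg a b f = 0 ->
  forall t, a < t < b -> f t = 0.
Proof.
move=> cf f0 I0 t /andP[at_ tb].
have mono x y : a <= x -> x <= y -> y <= b -> 0 <= itg x y f.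
  move=> ax xy yb; apply: itg_ge0 => // u /andP[xu uy]; apply: f0.
  by rewrite (le_trans ax) //= (le_trans uy).
have z s : a < s < b -> itg a s f = 0.
  move=> /andP[/ltW a_s /ltW sb].
  have := mono _ _ (lexx a) a_s sb; have := mono _ _ a_s sb (lexx b).
  by move: I0; rewrite (itg_cat s); lra.
have d0 : is_derive t 1 (fun b => itg a b f) 0.
  apply: (@near_eq_is_derive _ _ _ (cst 0)) => //.
  near=> y; apply/esym/z/andP; split; near: y.
    exact: lt_nbhsr.
  exact: lt_nbhsl.
have df := itg_derive a t cf.
have e1 := @derive_val _ _ _ _ _ _ _ df.
by have e2 := @derive_val _ _ _ _ _ _ _ d0; rewrite -e1 e2.
Unshelve. all: by end_near. Qed.

End itg.

(** * Parametric integrals and the Green operator *)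

Lemma row_cvg (R : realType) (N : nat) (T : Type) (F : set_system T) (FF : Filter F)
    (f : T -> 'rV[R]_N) (l : 'rV[R]_N) :
  (forall i, (fun z => f z 0 i) @ F --> l 0 i) -> f @ F --> l.
Proof.
move=> cf; apply/cvgrPdist_le => e e0 /=; near=> q.
rewrite /Num.Def.normr/= mx_normrE (bigmax_le _ (ltW e0))//= => -[k i] _.
rewrite !mxE /= ord1; move: i; near: q; apply: filter_forall => /= i.
exact: ((cvgrPdist_le _ _).1 (cf i)).
Unshelve. all: by end_near. Qed.

(** By compactness of a segment, h p tends to h p0 uniformly in t on it; the error splits into a
    change of the upper end and a change of the parameter. *)
Lemma itg_param_cont (R : realType) (P : topologicalType) (h : P -> R -> R) :
  continuous (fun z : P * R => h z.1 z.2) ->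
  continuous (fun z : P * R => itg 0 z.2 (h z.1)).
Proof.
move=> ch [p0 t0].
have chp p : continuous (h p).
  have H := cont_comp (cont_pair (cont_cst (A := R) p) cont_id) ch.
  exact: H.
apply/cvgrPdist_lt => e e0 /=.
(* M bounds all upper ends close to t0, so a tolerance of e / 2 / M on the integrand costs at most e
   / 2 after integration. *)
pose M := `|t0| + 1.
have M0 : 0 < M by rewrite ltr_wpDl.
have d0 : 0 < e / 2 / M by rewrite !divr_gt0.
have near1 : \forall p \near p0, `[-M, M] `<=` [set t | `|h p0 t - h p t| < e / 2 / M].
  apply: (compact_near_coveringP _).1; first exact: segment_compact.
  move=> t _.
  have e2 : 0 < e / 2 / M / 2 by rewrite divr_gt0.
  near=> z.
  have A : `|h p0 t - h z.2 z.1| < e / 2 / M / 2.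
    near: z.
    have cz := cont_B (cont_cst (A :=
      (R * P)%type) (h p0 t)) (cont_comp (cont_pair cont_snd cont_fst) ch).
    have := cz (t, p0); rewrite /continuous_at /=.
    rewrite subrr => /cvgrPdist_lt /(_ _ e2); apply: filterS => z.
    by rewrite sub0r normrN.
  have B : `|h p0 t - h p0 z.1| < e / 2 / M / 2.
    near: z.
    have cz := cont_B (cont_cst (A := (R * P)%type) (h p0 t)) (cont_comp cont_fst (chp p0)).
    have := cz (t, p0); rewrite /continuous_at /=.
    rewrite subrr => /cvgrPdist_lt /(_ _ e2); apply: filterS => z.
    by rewrite sub0r normrN.
  rewrite /=; have -> : h p0 z.1 - h z.2 z.1 =
    (h p0 t - h z.2 z.1) - (h p0 t - h p0 z.1) by ring.
  by rewrite (le_lt_trans (ler_normB _ _)) // [ltRHS]splitr ltrD.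
have near2 : \forall t \near t0, `|itg 0 t0 (h p0) - itg 0 t (h p0)| < e / 2.
  by have := @itg_cont R 0 _ (chp p0) t0 => /cvgrPdist_lt; apply; rewrite divr_gt0.
have near3 : \forall t \near t0, `|t| < M.
  have := @norm_continuous _ _ t0 => /cvgrPdist_lt /(_ 1 ltr01).
  apply: filterS => t; rewrite ltr_distl => /andP[+ _].
  by rewrite ltrBlDr.
near=> z.
have tM : `|z.2| < M by near: z; exact: (@cont_snd P R (p0, t0) _ near3).
have t2 : `|itg 0 t0 (h p0) - itg 0 z.2 (h p0)| < e / 2.
  by near: z; exact: (@cont_snd P R (p0, t0) _ near2).
have pM : `[-M, M] `<=` [set t | `|h p0 t - h z.1 t| < e / 2 / M].
  by near: z; exact: (@cont_fst P R (p0, t0) _ near1).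
have t1 : `|itg 0 z.2 (h p0) - itg 0 z.2 (h z.1)| <= e / 2.
  rewrite -itgB //.
  have cB : continuous (fun t => h p0 t - h z.1 t).
    by move=> t; apply: cvgB; exact: chp.
  have bnd a b : a <= b -> - M <= a -> b <= M ->
    `|itg a b (fun t => h p0 t - h z.1 t)| <= e / 2 / M * (b - a).
    move=> ab Ma bM; apply: itg_abs_le => // t /andP[at_ tb]; apply/ltW/pM.
    by rewrite /= in_itv /= (le_trans Ma) //= (le_trans tb).
  move: tM; rewrite ltr_norml => /andP[/ltW M1 /ltW M2].
  have [z0|/ltW z0] := leP 0 z.2.
    apply: (le_trans (bnd _ _ z0 _ M2)); first by rewrite oppr_le0 ltW.
    by rewrite subr0 -mulrA ger_pMr ?divr_gt0 // mulrC ler_pdivrMr // mul1r.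
  rewrite /itg distrC -/(itg _ _ _).
  apply: (le_trans (bnd _ _ z0 M1 _)); first exact: ltW.
  by rewrite sub0r -mulrA ger_pMr ?divr_gt0 // mulrC ler_pdivrMr // mul1r lerNl.
have -> : itg 0 t0 (h p0) - itg 0 z.2 (h z.1) = (itg 0 t0 (h p0) - itg 0 z.2 (h p0)) +
   (itg 0 z.2 (h p0) - itg 0 z.2 (h z.1)) by ring.
by rewrite (le_lt_trans (ler_normD _ _)) // [ltRHS]splitr ltr_leD.
Unshelve. all: by end_near. Qed.

Lemma itg_param_cont_ab (R : realType) (P : topologicalType) (h : P -> R -> R)
    (a b : R) :
  continuous (fun z : P * R => h z.1 z.2) ->
  continuous (fun p : P => itg a b (h p)).
Proof.
move=> ch p; have ct (c : R) : continuous (fun p : P => itg 0 c (h p)).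
  exact: (cont_comp (cont_pair cont_id (cont_cst (A := P) c)) (itg_param_cont ch)).
rewrite (_ : (fun p => _) = (fun p => itg 0 b (h p) - itg 0 a (h p))).
  by apply: cvgB; exact: ct.
by apply/funext => q; rewrite /itg; ring.
Qed.

(** * Euclidean inner product and coordinatewise derivatives *)

Section dotv.
Context {R : realType} {N : nat}.
Implicit Types u v w : 'rV[R]_N.

Lemma dotvC u v : dotv u v = dotv v u.
Proof. by apply: eq_bigr => i _; rewrite mulrC. Qed.

Lemma dotvDl u v w : dotv (u + v) w = dotv u w + dotv v w.
Proof. by rewrite -big_split; apply: eq_bigr => i _; rewrite mxE mulrDl. Qed.

Lemma dotvZl (k : R) u v : dotv (k *: u) v = k * dotv u v.
Proof. by rewrite /dotv mulr_sumr; apply: eq_bigr => i _; rewrite mxE mulrA. Qed.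

Lemma dotvNl u v : dotv (- u) v = - dotv u v.
Proof. by rewrite -scaleN1r dotvZl mulN1r. Qed.

Lemma dotvDr u v w : dotv w (u + v) = dotv w u + dotv w v.
Proof. by rewrite !(dotvC w) dotvDl. Qed.

Lemma dotvZr (k : R) u v : dotv v (k *: u) = k * dotv v u.
Proof. by rewrite !(dotvC v) dotvZl. Qed.

Lemma dotvNr u v : dotv v (- u) = - dotv v u.
Proof. by rewrite !(dotvC v) dotvNl. Qed.

Lemma dot0v v : dotv 0 v = 0.
Proof. by rewrite -(scale0r 0) dotvZl mul0r. Qed.

Lemma dotv0 v : dotv v 0 = 0.
Proof. by rewrite dotvC dot0v. Qed.

Definition dotvE := (dotvDl, dotvDr, dotvNl, dotvNr, dotvZl, dotvZr, dot0v, dotv0).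

Lemma dotv_ge0 u : 0 <= dotv u u.
Proof. by apply: sumr_ge0 => i _; rewrite -expr2 sqr_ge0. Qed.

Lemma coord_sqr_le u (i : 'I_N) : (u 0 i) ^+ 2 <= dotv u u.
Proof.
rewrite /dotv (bigD1 i) //= expr2 lerDl.
by apply: sumr_ge0 => j _; rewrite -expr2 sqr_ge0.
Qed.

Lemma dotv_eq0 u : dotv u u = 0 -> u = 0.
Proof.
move=> u0; apply/rowP => i; rewrite mxE; apply/eqP; rewrite -sqrf_eq0 -[_ == _]orbF.
by rewrite orbF eq_le sqr_ge0 andbT -u0 coord_sqr_le.
Qed.

Lemma dotv_gt0 u : u != 0 -> 0 < dotv u u.
Proof.
by move=> u0; rewrite lt_neqAle dotv_ge0 andbT eq_sym; apply: contra_neq u0 => /dotv_eq0.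
Qed.

Lemma enorm_sqr u : enorm u ^+ 2 = dotv u u.
Proof. by rewrite sqr_sqrtr // dotv_ge0. Qed.

Lemma row_cont (P : topologicalType) (x : P -> 'rV[R]_N) :
  (forall i, continuous (fun p => x p 0 i)) <-> continuous x.
Proof.
split=> [cx p|cx i]; first by apply: row_cvg => i; exact: cx.
exact: cont_comp cx (@coord_continuous _ _ _ 0 i).
Qed.

Lemma dotv_cont (P : topologicalType) (x y : P -> 'rV[R]_N) :
  continuous x -> continuous y -> continuous (fun p => dotv (x p) (y p)).
Proof.
move=> /row_cont cx /row_cont cy p; apply: cvg_big => [|i _].
  exact: add_continuous.
by apply: cvgM; [exact: cx|exact: cy].
Qed.

(** Vector derivatives are handled coordinate by coordinate, so that all calculus is done on real
    functions; [vder_derive1] returns to the derivative of the vector function at the end. *)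
Definition vder (x : R -> 'rV[R]_N) (dx : 'rV[R]_N) (t : R) :=
  forall i, is_derive t 1 (fun u : R => x u 0 i) (dx 0 i).

Lemma dotv_derive (x y : R -> 'rV[R]_N) (dx dy : 'rV[R]_N) (t : R) :
  vder x dx t -> vder y dy t ->
  is_derive t 1 (fun u : R => dotv (x u) (y u)) (dotv dx (y t) + dotv (x t) dy).
Proof.
move=> hx hy.
have -> : (fun u : R => dotv (x u) (y u)) =
    \sum_(i < N) ((fun u : R => x u 0 i) * (fun u : R => y u 0 i) : R -> R).
  by rewrite fct_sumE; apply/funext => u; apply: eq_bigr => i _.
have h i : is_derive t 1 ((fun u : R => x u 0 i) * (fun u : R => y u 0 i))
    (dx 0 i * y t 0 i + x t 0 i * dy 0 i).
  have hxi := hx i; have hyi := hy i; apply: is_derive_eq.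
  by rewrite /GRing.scale /=; ring.
apply: is_derive_eq; rewrite big_split /=.
by congr (_ + _).
Qed.

Lemma vder_cst (c : 'rV[R]_N) (t : R) : vder (fun=> c) 0 t.
Proof. by move=> i; rewrite mxE; exact: is_derive_cst. Qed.

Lemma vder_cont (x dx : R -> 'rV[R]_N) : (forall t, vder x (dx t) t) -> continuous x.
Proof. by move=> h; apply/row_cont => i; apply: is_derive_cont => t; exact: h. Qed.

End dotv.

Section green.
Context {R : realType} {N : nat}.
Variable tau : R.
Implicit Types f g x y : R -> 'rV[R]_N.

Definition vprim f (t : R) : 'rV[R]_N := \row_i itg 0 t (fun r => f r 0 i).

(* The solution of x'' = - f, x'(0) = 0, x(tau) = 0. *)
Definition green f (t : R) : 'rV[R]_N := \row_i itg t tau (fun r => vprim f r 0 i).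

Lemma vprim_der f t : continuous f -> vder (vprim f) (f t) t.
Proof.
move=> /row_cont cf i; rewrite (_ : (fun u => _) = (fun u => itg 0 u (fun r => f r 0 i))).
  by apply: itg_derive; exact: cf.
by apply/funext => u; rewrite mxE.
Qed.

Lemma vprim_cont f : continuous f -> continuous (vprim f).
Proof. by move=> cf; apply: (vder_cont (dx := f)) => t; exact: vprim_der. Qed.

Lemma vprim0 f : vprim f 0 = 0.
Proof. by apply/rowP => i; rewrite !mxE itgxx. Qed.

Lemma green_der f t : continuous f -> vder (green f) (- vprim f t) t.
Proof.
move=> cf i; have cp := (row_cont _).2 (vprim_cont cf) i.
have d := itg_derive tau t cp.
rewrite (_ : (fun u => _) = - (fun u => itg tau u (fun r => vprim f r 0 i))).
  by rewrite mxE; exact: is_deriveN.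
by apply/funext => u; rewrite mxE !fctE /itg; ring.
Qed.

Lemma green_cont f : continuous f -> continuous (green f).
Proof. by move=> cf; apply: (vder_cont (dx :=
  fun t => - vprim f t)) => t; exact: green_der. Qed.

Lemma green_tau f : green f tau = 0.
Proof. by apply/rowP => i; rewrite !mxE itgxx. Qed.

Lemma vprimD f g : continuous f -> continuous g ->
  vprim (fun t => f t + g t) = (fun t => vprim f t + vprim g t).
Proof.
move=> /row_cont cf /row_cont cg; apply/funext => t; apply/rowP => i; rewrite !mxE -itgD //.
by congr (itg 0 t _); apply/funext => r; rewrite mxE.
Qed.

Lemma vprimZ (k : R) f : continuous f ->
  vprim (fun t => k *: f t) = (fun t => k *: vprim f t).
Proof.
move=> /row_cont cf; apply/funext => t; apply/rowP => i; rewrite !mxE -itgZ //.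
by congr (itg 0 t _); apply/funext => r; rewrite mxE.
Qed.

Lemma greenD f g : continuous f -> continuous g ->
  green (fun t => f t + g t) = (fun t => green f t + green g t).
Proof.
move=> cf cg; rewrite /green vprimD //; apply/funext => t; apply/rowP => i;
  rewrite !mxE -itgD //.
- by congr (itg t tau _); apply/funext => r; rewrite mxE.
- exact: (row_cont _).2 (vprim_cont cf) i.
- exact: (row_cont _).2 (vprim_cont cg) i.
Qed.

Lemma greenZ (k : R) f : continuous f ->
  green (fun t => k *: f t) = (fun t => k *: green f t).
Proof.
move=> cf; rewrite /green vprimZ //; apply/funext => t; apply/rowP => i; rewrite !mxE -itgZ //.
- by congr (itg t tau _); apply/funext => r; rewrite mxE.
- exact: (row_cont _).2 (vprim_cont cf) i.
Qed.

Lemma greenB f g : continuous f -> continuous g ->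
  green (fun t => f t - g t) = (fun t => green f t - green g t).
Proof.
move=> cf cg; have cg' := cont_Z (cont_cst (- 1 : R)) cg.
transitivity (green (fun t => f t + - 1 *: g t)).
  by congr green; apply/funext => t; rewrite scaleN1r.
by rewrite greenD // greenZ //; apply/funext => t; rewrite scaleN1r.
Qed.

Definition ip (a : R) f x : R := itg 0 a (fun t => dotv (f t) (x t)).

Lemma ipC a f g : ip a f g = ip a g f.
Proof. by congr (itg _ _ _); apply/funext => t; rewrite dotvC. Qed.

Lemma ipDl a f g x : continuous f -> continuous g -> continuous x ->
  ip a (fun t => f t + g t) x = ip a f x + ip a g x.
Proof.
move=> cf cg cx; rewrite /ip -itgD; try exact: dotv_cont.
by congr (itg _ _ _); apply/funext => t; rewrite dotvDl.
Qed.

Lemma ipZl a (k : R) f x : continuous f -> continuous x ->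
  ip a (fun t => k *: f t) x = k * ip a f x.
Proof.
move=> cf cx; rewrite /ip -itgZ; try exact: dotv_cont.
by congr (itg _ _ _); apply/funext => t; rewrite dotvZl.
Qed.

Lemma ipDr a f g x : continuous f -> continuous g -> continuous x ->
  ip a x (fun t => f t + g t) = ip a x f + ip a x g.
Proof. by move=> *; rewrite ipC ipDl // !(ipC _ x). Qed.

Lemma ipZr a (k : R) f x : continuous f -> continuous x ->
  ip a x (fun t => k *: f t) = k * ip a x f.
Proof. by move=> *; rewrite ipC ipZl // !(ipC _ x). Qed.

Lemma ipBl a f g x : continuous f -> continuous g -> continuous x ->
  ip a (fun t => f t - g t) x = ip a f x - ip a g x.
Proof.
move=> cf cg cx; rewrite /ip -itgB; try exact: dotv_cont.
by congr (itg _ _ _); apply/funext => t; rewrite dotvDl dotvNl.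
Qed.

Lemma ipBr a f g x : continuous f -> continuous g -> continuous x ->
  ip a x (fun t => f t - g t) = ip a x f - ip a x g.
Proof. by move=> *; rewrite ipC ipBl // !(ipC _ x). Qed.

Lemma ip_ge0 a f : continuous f -> 0 <= a -> 0 <= ip a f f.
Proof. by move=> cf a0; apply: itg_ge0 => // [|t _]; [exact: dotv_cont|exact: dotv_ge0]. Qed.

(** Integration by parts, with (K g)' = - [vprim g] and [vprim f 0 = 0]. At a = tau the boundary
    term vanishes: K is symmetric, and <f, K f> is the kinetic energy of K f. *)
Lemma ip_green a f g : continuous f -> continuous g ->
  ip a f (green g) = dotv (vprim f a) (green g a) + ip a (vprim f) (vprim g).
Proof.
move=> cf cg.
have cvf := vprim_cont cf; have cvg_ := vprim_cont cg; have cKg := green_cont cg.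
have d (t : R) : is_derive t 1 (fun u : R => dotv (vprim f u) (green g u))
    (dotv (f t) (green g t) - dotv (vprim f t) (vprim g t)).
  by rewrite -dotvNr; apply: dotv_derive; [exact: vprim_der|exact: green_der].
have c1 := dotv_cont cf cKg; have c2 := dotv_cont cvf cvg_.
have := itgE 0 a d (cont_B c1 c2); rewrite (itgB _ _ c1 c2) vprim0 dot0v subr0.
by rewrite /ip => <-; rewrite subrK.
Qed.

Lemma ip_greenC f g : continuous f -> continuous g ->
  ip tau f (green g) = ip tau g (green f).
Proof. by move=> cf cg; rewrite !ip_green // !green_tau !dotv0 !add0r ipC. Qed.

(* Expands the integral over [b, c] of |F + v - G|^2, where F' = f and G' = g. *)
Lemma green_square f g v (b c : R) : continuous f -> continuous g -> b <= c ->
  0 <= itg b c (fun t => dotv (vprim f t) (vprim f t)) - 2 * itg b c (fun t => dotv (vprim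
    f t) (vprim g t))
     + itg b c (fun t => dotv (vprim g t) (vprim g t)) + 2 * dotv v (green f b - green f c)
     - 2 * dotv v (green g b - green g c) + dotv v v * (c - b).
Proof.
move=> cf cg bc; set p := vprim f; set q := vprim g.
have cp : continuous p := vprim_cont cf. have cq : continuous q := vprim_cont cg.
have cd x y : continuous x -> continuous y -> continuous (fun t => dotv (x t) (y t)) :=
  @dotv_cont _ _ _ x y.
have dv f0 (t : R) : continuous f0 ->
  is_derive t 1 (fun u : R => dotv v (green f0 u)) (- dotv v (vprim f0 t)).
  move=> cf0; have := dotv_derive (vder_cst v t) (green_der t cf0).
  by rewrite dot0v add0r dotvNr.
(* The derivative of [H] is |p + v - q|^2, so the inequality is the monotonicity of [H]. *)
pose H := fun c => itg b c (fun t => dotv (p t) (p t)) - 2 * itg b c (fun t => dotv (p t)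
  (q t))
     + itg b c (fun t => dotv (q t) (q t)) - 2 * dotv v (green f c)
     + 2 * dotv v (green g c) + dotv v v * c.
have gen (F1 F2 F3 F4 F5 : R -> R) (d1 d2 d3 d4 d5 k t : R) :
    is_derive t 1 F1 d1 -> is_derive t 1 F2 d2 -> is_derive t 1 F3 d3 ->
    is_derive t 1 F4 d4 -> is_derive t 1 F5 d5 ->
    is_derive t 1 (fun c => F1 c - 2 * F2 c + F3 c - 2 * F4 c + 2 * F5 c + k * c)
      (d1 - 2 * d2 + d3 - 2 * d4 + 2 * d5 + k).
  move=> e1 e2 e3 e4 e5.
  have e6 := is_deriveZ k (is_derive_id t 1).
  have := is_deriveD (is_deriveD (is_deriveB (is_deriveD (is_deriveB e1 (is_deriveZ 2 e2)) e3)
    (is_deriveZ 2 e4)) (is_deriveZ 2 e5)) e6.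
  by rewrite /GRing.scale /= mulr1.
have dH t := gen _ _ _ _ _ _ _ _ _ _ (dotv v v) t
  (itg_derive b t (cd _ _ cp cp)) (itg_derive b t (cd _ _ cp cq))
  (itg_derive b t (cd _ _ cq cq)) (dv f t cf) (dv g t cg).
have : H b <= H c.
  apply: (is_derive_ge0 bc (fun t _ => dH t)) => t _.
  have := dotv_ge0 (p t + v - q t); rewrite !dotvE -/(p t) -/(q t).
  rewrite (dotvC (q t) (p t)) (dotvC v (p t)) (dotvC v (q t)); lra.
rewrite /H !itgxx !dotvE; lra.
Qed.

End green.

(** * The Dirichlet energy by duality *)

Section energy.
Context {R : realType} {N : nat}.
Variable tau : R.
Hypothesis tau0 : 0 < tau.
Implicit Types f g x y : R -> 'rV[R]_N.
Local Notation K := (green tau).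

Lemma vprim_0 : vprim (fun=> 0) = (fun=> 0) :> (R -> 'rV[R]_N).
Proof.
have := @vprimZ R N 0 (fun=> 0) (cont_cst (0 : 'rV[R]_N)).
rewrite (_ : (fun t => _) = (fun=> 0)); last by apply/funext => t; rewrite scale0r.
by move=> ->; apply/funext => t; rewrite scale0r.
Qed.

Lemma green_0 : K (fun=> 0) = (fun=> 0) :> (R -> 'rV[R]_N).
Proof.
have := @greenZ R N tau 0 (fun=> 0) (cont_cst (0 : 'rV[R]_N)).
rewrite (_ : (fun t => _) = (fun=> 0)); last by apply/funext => t; rewrite scale0r.
by move=> ->; apply/funext => t; rewrite scale0r.
Qed.

Lemma ip_0l (a : R) x : ip a (fun=> 0) x = 0.
Proof.
rewrite /ip (_ : (fun t => _) = (fun=> 0)); first by rewrite itg_cst mul0r.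
by apply/funext => t; rewrite dot0v.
Qed.

Lemma green_square0 f v (b c : R) : continuous f -> b <= c ->
  0 <= itg b c (fun t => dotv (vprim f t) (vprim f t))
     + 2 * dotv v (K f b - K f c) + dotv v v * (c - b).
Proof.
move=> cf bc; have := green_square tau v cf (cont_cst (0 : 'rV[R]_N)) bc.
rewrite vprim_0 green_0 subr0 dotv0.
rewrite (_ : (fun t => dotv (vprim f t) 0) = (fun=> 0)); last first.
  by apply/funext => t; rewrite dotv0.
by rewrite !itg_cst !dotv0 !mul0r !mulr0 subr0 addr0 subr0.
Qed.

(* The bound [int_0^tau |x'|^2 <= e] in dual form: as f ranges over continuous
   functions with primitive F and [s, t] over subintervals, it says that
   2 <f, x> + 2 v.(x s - x t) - |F + v 1_[s, t]|^2 <= e. Being a family of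
   closed affine conditions on x, it needs no weak derivative and passes to
   pointwise limits. *)
Definition energy_le x (e : R) :=
  [/\ continuous x, x tau = 0 &
    forall f v s t, continuous f -> 0 <= s -> s <= t -> t <= tau ->
      2 * ip tau f x + 2 * dotv v (x s - x t)
      - (ip tau f (K f) + 2 * dotv v (K f s - K f t) + dotv v v * (t - s)) <= e].

Lemma energy_ge0 x e : energy_le x e -> 0 <= e.
Proof.
case=> _ _ /(_ (fun=> 0) 0 0 0 (cont_cst (0 : 'rV[R]_N)) (lexx _) (lexx _) (ltW tau0)).
by rewrite !ip_0l !dot0v; lra.
Qed.

Lemma energy_ip x e f : energy_le x e -> continuous f ->
  2 * ip tau f x - ip tau f (K f) <= e.
Proof.
case=> _ _ H cf; have := H f 0 0 0 cf (lexx _) (lexx _) (ltW tau0).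
by rewrite !dot0v; lra.
Qed.

(** The Cauchy-Schwarz bound on the increment of x, in dual form: f = 0 and v = (x s - x t) / (t -
    s), which maximizes 2 v.(x s - x t) - |v|^2 (t - s). *)
Lemma energy_holder x e s t : energy_le x e -> 0 <= s -> s <= t -> t <= tau ->
  dotv (x s - x t) (x s - x t) <= e * (t - s).
Proof.
case=> _ _ H s0; rewrite le_eqVlt => /predU1P[<- _|st ttau].
  by rewrite !subrr dotv0 mulr0.
have ts : 0 < t - s by rewrite subr_gt0.
have := H (fun=> 0) ((t - s)^-1 *: (x s - x t)) s t (cont_cst (0 : 'rV[R]_N)) s0 (ltW st) ttau.
rewrite green_0 !ip_0l subrr dotv0 mulr0 !add0r !(dotvZl, dotvZr) => /=.
set D := dotv _ _ => h.
rewrite -ler_pdivrMr //; apply: le_trans h.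
rewrite le_eqVlt; apply/orP; left; apply/eqP; field.
by rewrite gt_eqF.
Qed.

(** The test data (f, v) for k x correspond to (f / k, v / k) for x, whence k <> 0. *)
Lemma energyZ x e (k : R) : k != 0 -> energy_le x e ->
  energy_le (fun t => k *: x t) (k ^+ 2 * e).
Proof.
move=> k0 [cx xt H]; split=> [||f v s t cf s0 st tt].
- exact: cont_Z (cont_cst k) cx.
- by rewrite xt scaler0.
have cf' : continuous (fun t => k^-1 *: f t) by exact: cont_Z (cont_cst _) cf.
have cKf := @green_cont R N tau _ cf.
have cZKf : continuous (fun t => k^-1 *: K f t) by exact: cont_Z (cont_cst _) cKf.
have := H _ (k^-1 *: v) _ _ cf' s0 st tt.
rewrite (greenZ _ _ cf) (ipZl _ _ cf cx) (ipZl _ _ cf cZKf) (ipZr _ _ cKf cf).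
rewrite (ipZr _ _ cx cf) -!scalerBr !(dotvZl, dotvZr) => h.
have k2 : 0 < k ^+ 2 by rewrite exprn_even_gt0.
rewrite -ler_pdivrMl //; apply: le_trans h; rewrite le_eqVlt; apply/orP; left.
by apply/eqP; field.
Qed.

(** The expansion of int |x' + (K g)'|^2, whose cross term is <g, x> by parts; dually, the test
    function f for the sum becomes f - g for x. *)
Lemma energyD_green x e g : energy_le x e -> continuous g ->
  energy_le (fun t => x t + K g t) (e + 2 * ip tau g x + ip tau g (K g)).
Proof.
move=> [cx xt H] cg; have cKg := @green_cont R N tau _ cg; split=> [||f v s t cf s0 st tt].
- exact: cont_D.
- by rewrite xt green_tau addr0.
have cf' : continuous (fun t => f t - g t) by exact: cont_B.
have cKf := @green_cont R N tau _ cf; have cKB := cont_B cKf cKg.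
have := H _ v _ _ cf' s0 st tt.
rewrite (greenB tau cf cg) (ipBl _ cf cg cx) (ipBl _ cf cg cKB).
rewrite (ipBr _ cKf cKg cf) (ipBr _ cKf cKg cg) (ipDr _ cx cKg cf).
rewrite (ip_greenC tau cg cf) !dotvE; lra.
Qed.

(** The truncation has derivative - [vprim g] on [0, a] and 0 beyond. With F and G the primitives of
    f and g, the claim says that the integral of |F + v 1_[s, t] - G 1_[0, a]|^2 is nonnegative. As
    K g a = 0, the integral of |G|^2 over [0, a] is [ip a g (K g)]. *)
Lemma energy_trunc g (a : R) : continuous g -> 0 <= a <= tau -> K g a = 0 ->
  energy_le (fun t => K g (Num.min t a)) (ip a g (K g)).
Proof.
move=> cg /andP[a0 at_] Ka; have cKg := @green_cont R N tau _ cg.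
have cy : continuous (fun t : R => K g (Num.min t a)).
  apply: (cont_comp _ cKg) => t.
  by apply: (@continuous_min _ _ id (cst a)); [exact: cvg_id|exact: cvg_cst].
split=> // [|f v s t cf s0 st tt]; first by rewrite min_r.
have cvf := vprim_cont cf; have cvg_ := vprim_cont cg.
have -> : ip tau f (fun t => K g (Num.min t a)) = ip a (vprim f) (vprim g).
  rewrite /ip (itg_cat a).
  have cfy : continuous (fun t => dotv (f t) (K g (Num.min t a))) := dotv_cont cf cy.
  have cfK : continuous (fun t => dotv (f t) (K g t)) := dotv_cont cf cKg.
  rewrite (itg_eq cfy cfK a0); last by move=> u /andP[_ ua]; rewrite min_l.
  rewrite (itg_eq cfy (cont_cst (0 : R)) at_); last first.
    by move=> u /andP[au _]; rewrite min_r // Ka dotv0.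
  by rewrite -/(ip a f (K g)) ip_green // Ka dotv0 add0r itg_cst mul0r addr0.
rewrite !ip_green // Ka green_tau !dotv0 !add0r.
(* The square is split at s, t and a, according to their order: [Q] serves the pieces in [0, a],
   [Q0] those beyond a, and v enters on [s, t] only. *)
have Q b c u bc := @green_square R N tau f g u b c cf cg bc.
have Q0 b c u bc := @green_square0 f u b c cf bc.
have [ta|/ltW at'] := leP t a.
  have sa := le_trans st ta.
  rewrite (min_l sa).
  have := Q _ _ 0 s0; have := Q _ _ v st; have := Q _ _ 0 ta; have := Q0 _ _ 0 at_.
  rewrite /ip /itg !dotvE; lra.
have [sa|/ltW as_] := leP s a.
  have := Q _ _ 0 s0; have := Q _ _ v sa; have := Q0 _ _ v at'; have := Q0 _ _ 0 tt.
  rewrite /ip /itg Ka !dotvE; lra.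
have := Q _ _ 0 a0; have := Q0 _ _ 0 as_; have := Q0 _ _ v st; have := Q0 _ _ 0 tt.
rewrite /ip /itg Ka !dotvE; lra.
Qed.

(** The energy bound sees x on [0, tau] only. Freezing x outside makes the Hölder estimate hold on
    all of R, so that limits of such functions are continuous on R. *)
Lemma energy_clamp x e : energy_le x e ->
  let y := fun t => x (Num.max 0 (Num.min t tau)) in
  energy_le y e /\ forall s t, dotv (y s - y t) (y s - y t) <= e * `|s - t|.
Proof.
move=> Hx y; have e0 := energy_ge0 Hx; have [cx xt H] := Hx.
have tau0' := ltW tau0.
have yE t : 0 <= t <= tau -> y t = x t.
  by move=> /andP[t0 tt]; rewrite /y min_l // max_r.
have cy : continuous y.
  apply: (cont_comp _ cx) => t;
    apply: (@continuous_max _ _ (cst 0) (fun t : R => Num.min t tau)); first exact: cvg_cst.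
  by apply: (@continuous_min _ _ id (cst tau)); [exact: cvg_id|exact: cvg_cst].
split; first split => //.
- by rewrite yE // lexx tau0'.
- move=> f v s t cf s0 st tt; rewrite !yE ?s0 ?tt ?(le_trans s0 st) ?(le_trans st tt) //.
  rewrite (_ : ip tau f y = ip tau f x); first exact: H.
  by apply: (itg_eq (dotv_cont cf cy) (dotv_cont cf cx) tau0') => u /yE ->.
have main s t : s <= t -> dotv (y s - y t) (y s - y t) <= e * (t - s).
  move=> st; apply: (le_trans (energy_holder Hx _ _ _)).
  - by rewrite le_max lexx.
  - by rewrite ge_max !le_max lexx /=; apply/orP; right; rewrite le_min !ge_min st lexx orbT.
  - by rewrite ge_max tau0' ge_min lexx orbT.
  apply: ler_wpM2l => //.
  by have [] := leP t tau; have [] := leP s tau; have [] := leP 0 s; have [] :=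
    leP 0 t; have [] := leP 0 tau; lra.
move=> s t; have [st|/ltW ts] := leP s t.
  by rewrite distrC ger0_norm ?subr_ge0 //; exact: main.
rewrite ger0_norm ?subr_ge0 // -opprB dotvNl dotvNr opprK; exact: main.
Qed.

End energy.

(** * The potential *)

Section potential.
Context {R : realType} {N : nat}.
Implicit Types (v y z : 'rV[R]_N) (x : R -> 'rV[R]_N).

Lemma derive_row (h : 'rV[R]_N -> R) y v : differentiable h y ->
  'd h y v = \sum_(i < N) v 0 i * 'D_(delta_mx 0 i) h y.
Proof.
move=> dh; rewrite {1}(row_sum_delta v) linear_sum; apply: eq_bigr => i _.
by rewrite linearZ /= deriveE.
Qed.

Lemma derive_along (h : 'rV[R]_N -> R) x (dx : 'rV[R]_N) (t : R) :
  differentiable h (x t) -> vder x dx t ->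
  is_derive t 1 (fun u : R => h (x u)) (\sum_(i < N) dx 0 i * 'D_(delta_mx 0 i) h (x t)).
Proof.
move=> dh hx.
have ddx : derivable x t 1.
  by apply/derivable_mxP => i j; rewrite ord1; exact: (@ex_derive _ _ _ _ _ _ _ (hx j)).
have xE : 'D_1 x t = dx.
  by rewrite derive_mx //; apply/rowP => j; rewrite mxE;
    exact: (@derive_val _ _ _ _ _ _ _ (hx j)).
have dfx : differentiable x t by exact/derivable1_diffP.
have dc : differentiable (h \o x) t by exact: differentiable_comp.
apply: DeriveDef; first exact/derivable1_diffP.
have -> : 'D_1 (fun u : R => h (x u)) t = 'd (h \o x) t 1 by rewrite -deriveE.
by rewrite diff_comp //= -(@deriveE _ _ _ _ _ (1 : R) dfx) xE derive_row.
Qed.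

Variable V : 'rV[R]_N -> R.
Hypothesis hC2 : is_C2 V.

Lemma V_along x dx t : vder x dx t ->
  is_derive t 1 (fun u : R => V (x u)) (dotv (grad V (x t)) dx).
Proof.
case: hC2 => dV _ _ hx; have := derive_along (dV _) hx.
rewrite (_ : \sum_(_ < _) _ = dotv (grad V (x t)) dx) //.
by apply: eq_bigr => i _; rewrite mxE mulrC.
Qed.

Lemma grad_along x dx t : vder x dx t ->
  vder (fun u : R => grad V (x u)) (mxapp (hessian V (x t)) dx) t.
Proof.
case: hC2 => _ dG _ hx i.
have dGi : differentiable ('D_(delta_mx 0 i) V) (x t).
  rewrite (_ : 'D_(delta_mx 0 i) V = (fun M : 'rV[R]_N => M 0 i) \o grad V).
    by apply: differentiable_comp => //; exact: differentiable_coord.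
  by apply/funext => z /=; rewrite mxE.
have := derive_along dGi hx.
rewrite (_ : (fun u : R => grad V (x u) 0 i) = (fun u : R => 'D_(delta_mx 0 i) V (x u))).
  rewrite (_ : \sum_(_ < _) _ = mxapp (hessian V (x t)) dx 0 i) //.
  by rewrite /mxapp !mxE; apply: eq_bigr => j _; rewrite !mxE.
by apply/funext => u; rewrite mxE.
Qed.

Lemma V_cont : continuous V.
Proof. by case: hC2 => dV _ _ y; exact: differentiable_continuous. Qed.

Lemma grad_cont : continuous (grad V).
Proof. by case: hC2 => _ dG _ y; exact: differentiable_continuous. Qed.

Lemma vder_line y v (t : R) : vder (fun s => y + s *: v) v t.
Proof.
move=> i; rewrite (_ : (fun u : R => _) = cst (y 0 i) + (v 0 i) *: @id R).
  have := is_deriveD (is_derive_cst (y 0 i) t 1) (is_deriveZ (v 0 i) (is_derive_id t 1)).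
  by rewrite add0r /GRing.scale /= mulr1.
by apply/funext => u; rewrite !mxE !fctE /GRing.scale /= mulrC.
Qed.

Lemma vder_ray y (t : R) : vder (fun s => s *: y) y t.
Proof.
by have := vder_line 0 y t; rewrite (_ : (fun s : R => 0 + s *: y) = (fun s => s *: y)) //;
  apply/funext => s; rewrite add0r.
Qed.

(** Evenness identifies V on the line y + u w with V on the mirrored line. Differentiating at u = 0
    in the direction w = V'(-y) + V'(y) yields w.w = 0. *)
Lemma grad_odd : (forall y, V y = V (- y)) -> forall y, grad V (- y) = - grad V y.
Proof.
move=> V4 y; apply/eqP; rewrite -addr_eq0; apply/eqP; apply: dotv_eq0.
set w := _ + _.
have d1 := V_along (vder_line y w 0); rewrite scale0r addr0 in d1.
have d2 := V_along (vder_line (- y) (- w) 0); rewrite scale0r addr0 in d2.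
have E : (fun u : R => V (y + u *: w)) = (fun u : R => V (- y + u *: - w)).
  by apply/funext => u; rewrite V4 opprD scalerN.
have e1 := @derive_val _ _ _ _ _ _ _ d1; have e2 := @derive_val _ _ _ _ _ _ _ d2.
have : dotv (grad V y) w = dotv (grad V (- y)) (- w) by rewrite -e1 -e2 E.
by rewrite {1}/w dotvDl dotvNr; lra.
Qed.

Hypothesis V3 : forall y, y != 0 ->
  0 < dotv (grad V y) y /\ dotv (grad V y) y <= dotv (mxapp (hessian V y) y) y.
Hypothesis V4 : forall y, V y = V (- y).

Lemma grad0 : grad V 0 = 0.
Proof.
have := grad_odd V4 0; rewrite oppr0 => /eqP; rewrite -addr_eq0 => /eqP g.
by apply: dotv_eq0; have := congr1 (dotv (grad V 0)) g; rewrite dotvDr dotv0; lra.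
Qed.

Lemma dotv_grad_ge0 y : 0 <= dotv (grad V y) y.
Proof.
by have [->|/V3[/ltW]] := eqVneq y 0; rewrite ?dotv0.
Qed.

(* Condition (V3) makes V'(sy).y / s nondecreasing in s > 0. *)
Lemma grad_ray_mono y (s t : R) : 0 < s -> s <= t ->
  t * dotv (grad V (s *: y)) y <= s * dotv (grad V (t *: y)) y.
Proof.
move=> s0 st; have [->|y0] := eqVneq y 0; first by rewrite !dotv0 !mulr0.
have t0 : 0 < t := lt_le_trans s0 st.
pose g (r : R) := dotv (grad V (r *: y)) y.
pose dg (r : R) := dotv (mxapp (hessian V (r *: y)) y) y.
have dgP (r : R) : is_derive r 1 g (dg r).
  by have := dotv_derive (grad_along (vder_ray y r)) (vder_cst y r); rewrite dotv0 addr0.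
have dq (r : R) : 0 < r ->
  is_derive r 1 (g * (fun r => r^-1)) (g r * (- r ^- 2) + r^-1 * dg r).
  move=> r0; have di := is_deriveV (lt0r_neq0 r0) (is_derive_id r 1).
  by have := is_deriveM (dgP r) di; rewrite /GRing.scale /= mulr1.
have : (g * (fun r => r^-1)) s <= (g * (fun r => r^-1)) t.
  apply: (is_derive_ge0 st) => [r /andP[sr _]|r /andP[sr _]].
    by apply: dq; exact: lt_le_trans sr.
  have r0 : 0 < r := lt_le_trans s0 sr.
  have ry0 : r *: y != 0 by rewrite scaler_eq0 negb_or y0 gt_eqF.
  have [_] := V3 ry0.
  have -> : dotv (mxapp (hessian V (r *: y)) (r *: y)) (r *: y) = r ^+ 2 * dg r.
    by rewrite /mxapp -scalemxAl dotvZl dotvZr mulrA -expr2.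
  rewrite dotvZr -/(g r) => h.
  have -> : g r * - r ^- 2 + r^-1 * dg r = (r ^+ 2 * dg r - r * g r) / r ^+ 3.
    by field; rewrite gt_eqF.
  by rewrite divr_ge0 ?subr_ge0 // exprn_ge0 // ltW.
rewrite !fctE ler_pdivlMr // mulrAC ler_pdivrMr //; rewrite /g mulrC.
by rewrite [leRHS]mulrC.
Qed.

(** The function F r = V(r y) - r^2 / 2 V'(y).y has its minimum over r >= 0 at r = 1, since by
    [grad_ray_mono] its derivative V'(r y).y - r V'(y).y has the sign of r - 1. Integrated in time,
    this says that a Nehari point maximizes the action on its ray, even if not uniquely. *)
Lemma V_ray y (s : R) : 0 <= s ->
  V y + (s ^+ 2 - 1) / 2 * dotv (grad V y) y <= V (s *: y).
Proof.
move=> s0; set g1 := dotv _ _.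
pose F := (fun r : R => V (r *: y)) - (g1 / 2) *: ((fun r : R => r) ^+ 2).
have dF (r : R) : is_derive r 1 F (dotv (grad V (r *: y)) y - r * g1).
  have d1 := V_along (vder_ray y r); have d2 := is_deriveX 2 (is_derive_id r 1).
  have dh := is_deriveB d1 (is_deriveZ (g1 / 2) d2).
  apply: (@is_derive_eq _ _ _ _ _ _ _ _ dh).
  rewrite /GRing.scale /= expr1 mulr1.
  by congr (_ - _); rewrite -[2%:R]/2; field.
have FE r : F r = V (r *: y) - g1 / 2 * r ^+ 2 by [].
have mono r : 0 <= r -> F 1 <= F r.
  move=> r0; have [r1|/ltW r1] := leP 1 r.
    apply: (is_derive_ge0 r1 (fun t _ => dF t)) => t /andP[t1 _].
    have := @grad_ray_mono y 1 t ltr01 t1; rewrite scale1r -/g1; lra.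
  rewrite -lerN2.
  apply: (is_derive_ge0 (F := - F) r1 (fun t _ => is_deriveN (dF t))) => t /andP[rt t1].
  move: (le_trans r0 rt); rewrite le_eqVlt => /predU1P[<-|t0].
    by rewrite scale0r grad0 dot0v; lra.
  by have := @grad_ray_mono y t 1 t0 t1; rewrite scale1r -/g1; lra.
have := mono s s0; rewrite !FE scale1r; lra.
Qed.

Lemma V_gt (y : 'rV[R]_N) : y != 0 -> V 0 < V y.
Proof.
(* From y / 2 to y, [V_ray] gains 3 / 2 V'(z).z > 0 with z = y / 2, which gives strictness; between
   0 and z a weak inequality is enough. *)
move=> y0; have h2 := @V_ray (2^-1 *: y) 2 (ler0n _ _).
set z := 2^-1 *: y in h2.
have z0 : z != 0 by rewrite scaler_eq0 negb_or y0 invr_eq0 pnatr_eq0.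
have [gz _] := V3 z0.
have h0 : V (0 *: z) <= V (1 *: z).
  apply: (is_derive_ge0 (F :=
    fun t : R => V (t *: z)) ler01 (fun t _ => V_along (vder_ray z t))).
  move=> t /andP[]; rewrite le_eqVlt => /predU1P[<-|t0] _.
    by rewrite scale0r grad0 dot0v.
  by have := dotv_grad_ge0 (t *: z); rewrite dotvZr pmulr_rge0.
move: h0 h2; rewrite scale0r scale1r scalerA divff ?pnatr_eq0 // scale1r => h0 h2; lra.
Qed.

Hypothesis hN : (1 <= N)%N.
Hypothesis V1 : V x / enorm x ^+ 2 @[x --> (0 : 'rV[R]_N)^'] --> (0 : R).

Lemma V_small (e : R) : 0 < e -> exists2 r, 0 < r &
  forall y, dotv y y <= r -> y != 0 -> `|V y| <= e * dotv y y.
Proof.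
move=> e0; have /cvgrPdist_le/(_ _ e0) := V1.
rewrite /dnbhs /within /= => /nbhs_ballP [d /= d0 H].
(* The neighbourhood is a ball of the sup norm, which is at most the Euclidean norm; r bounds the
   square of the latter, and the factor 1 / 2 makes the inequality strict. *)
exists ((d / 2) ^+ 2); first by rewrite exprn_gt0 // divr_gt0.
move=> y yd y0; have yy := dotv_gt0 y0.
suff : `|V y / dotv y y| <= e.
  by rewrite normrM normfV (ger0_norm (ltW yy)) ler_pdivrMr.
have := H y; rewrite /= sub0r normrN enorm_sqr; apply => //.
rewrite -ball_normE /ball_ /= sub0r normrN; apply: (@le_lt_trans _ _ (d / 2)); last first.
  by rewrite ltr_pdivrMr // ltr_pMr // ltr1n.
rewrite /Num.Def.normr/= mx_normrE; apply: bigmax_le; first by rewrite ltW // divr_gt0.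
have d2 : 0 <= d / 2 by rewrite ltW // divr_gt0.
move=> [k i] _ /=; rewrite ord1 -ler_sqr ?nnegrE ?normr_ge0 // real_normK ?num_real //.
exact: le_trans (coord_sqr_le y i) yd.
Qed.

(** Along a unit vector c, which exists as N >= 1, (V1) gives |V(s c)| <= s^2 for small s > 0;
    continuity at 0 concludes. *)
Lemma V_0 : V 0 = 0.
Proof.
apply/eqP; rewrite -normr_le0; apply/ler_addgt0Pl => e e0.
have [r r0 H] := V_small ltr01.
pose k := Ordinal hN.
pose c : 'rV[R]_N := delta_mx 0 k.
have cc : dotv c c = 1.
  rewrite /dotv (bigD1 k) //= big1 ?addr0 => [|i /negbTE ik];
    rewrite !mxE /= ?ik ?andbF ?eqxx ?mulr0 //.
  by rewrite mulr1.
have cl : continuous (fun s : R => V (s *: c)).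
  exact: cont_comp (cont_Z cont_id (cont_cst c)) V_cont.
have := @cl 0; rewrite /continuous_at /= scale0r
  => /cvgrPdist_le/(_ _ (divr_gt0 e0 (ltr0n _ 2)))/= near0.
have near1 : \forall s \near (0 : R), s ^+ 2 < Num.min r (e / 2).
  have cs : continuous (fun s : R => s * s) := cont_M cont_id cont_id.
  have := @cs 0; rewrite /continuous_at /= mulr0 => /cvgrPdist_lt /(_ (Num.min r (e / 2))).
  rewrite lt_min r0 divr_gt0 // => /(_ isT).
  by apply: filterS => s; rewrite sub0r normrN ger0_norm -expr2 ?sqr_ge0.
have [s [s0 [a b]]] : exists s : R, 0 < s /\ `|V 0 - V (s *: c)| <=
  e / 2 /\ s ^+ 2 < Num.min r (e / 2).
  have : \forall s \near (0:R)^'+, 0 < s /\ `|V 0 - V (s *: c)| <=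
    e / 2 /\ s ^+ 2 < Num.min r (e / 2).
    near=> s; split=> //; split; near: s; exact: cvg_within.
  by move/filter_ex.
move: b; rewrite lt_min => /andP[b1 b2].
have sc : dotv (s *: c) (s *: c) = s ^+ 2 by rewrite dotvZl dotvZr cc mulr1 expr2.
have := H (s *: c); rewrite sc mul1r => /(_ (ltW b1)).
rewrite scaler_eq0 negb_or gt_eqF //= => h.
have c0 : c != 0 by apply/eqP => c0; move: cc; rewrite c0 dotv0; lra.
move: (h c0) => {}h.
have -> : V 0 = (V 0 - V (s *: c)) + V (s *: c) by rewrite subrK.
rewrite addr0; apply: le_trans (ler_normD _ _) _; lra.
Unshelve. all: by end_near. Qed.

Lemma V_ge0 y : 0 <= V y.
Proof. by have [->|/V_gt] := eqVneq y 0; rewrite V_0 // => /ltW. Qed.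

Lemma V_eq0 y : V y = 0 -> y = 0.
Proof. by move=> Vy; apply/eqP; apply: contraPT Vy => /V_gt; rewrite V_0 => /gt_eqF/eqP. Qed.

Lemma V_le_grad y : V y <= 2^-1 * dotv (grad V y) y.
Proof. by have := @V_ray y 0 (lexx _); rewrite scale0r V_0; lra. Qed.

Hypothesis V2 : cvg_pinfty_at_infty (fun x : 'rV[R]_N => V x / enorm x ^+ 2).

(** Outside a ball of radius M this is (V2); inside, C = A M^2 reduces it to V >= 0. *)
Lemma V_superquadratic (A : R) : 0 <= A ->
  exists2 C, 0 <= C & forall y, A * dotv y y - C <= V y.
Proof.
move=> A0; have [M HM] := V2 A.
exists (A * M ^+ 2); first by rewrite mulr_ge0 ?sqr_ge0.
move=> y; have [yM|yM] := ltP M (enorm y).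
  have [->|y0] := eqVneq y 0.
    by rewrite dotv0 V_0 mulr0 sub0r oppr_le0 mulr_ge0 ?sqr_ge0.
  have := HM y yM; rewrite enorm_sqr ltr_pdivlMr ?dotv_gt0 // => /ltW h.
  by apply: le_trans h; rewrite lerBlDr lerDl mulr_ge0 ?sqr_ge0.
apply: le_trans (V_ge0 y); rewrite subr_le0 ler_wpM2l // -enorm_sqr.
by rewrite ler_sqr ?nnegrE ?sqrtr_ge0 // (le_trans _ yM) // sqrtr_ge0.
Qed.

(** Integrating twice the lower bound - B of the Hessian form along the segment gives a remainder B
    / 2 e^2. B is uniform, the form being continuous on a compact box. This is the price of the
    gradient step in [D_small]. *)
Lemma V_taylor (M : R) : 0 <= M -> exists2 C, 0 <= C &
  forall y v (e : R), (forall i, `|y 0 i| <= M) -> (forall i, `|v 0 i| <= M) ->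
    0 <= e <= 1 -> V y - e * dotv (grad V y) v - C * e ^+ 2 <= V (y - e *: v).
Proof.
move=> M0; case: (hC2) => _ _ cH.
pose q (z : 'rV[R]_N * 'rV[R]_N) := dotv (mxapp (hessian V z.1) z.2) z.2.
have cq : continuous q.
  apply: dotv_cont (cont_snd); apply/row_cont => i.
  rewrite (_ : (fun p => _) = (fun p : 'rV[R]_N * 'rV[R]_N =>
      \sum_j p.2 0 j * hessian V p.1 i j)); last first.
    by apply/funext => p; rewrite /mxapp mxE; apply: eq_bigr => j _; rewrite mxE.
  move=> p; apply: cvg_big => [|j _]; first exact: add_continuous.
  apply: (@cont_M _ _ (fun p : 'rV[R]_N * 'rV[R]_N => p.2 0 j) (fun p => hessian V p.1 i j)).
    exact: cont_comp (cont_snd) (@coord_continuous _ _ _ 0 j).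
  exact: cont_comp (cont_comp (cont_fst) cH) (@coord_continuous _ _ _ i j).
pose A (m : R) := [set z : 'rV[R]_N | forall i, (`[- m, m]%classic : set R) (z ord0 i)].
have cA m : compact (A m).
  by apply: (rV_compact (A := fun=> `[- m, m]%classic)) => _; exact: segment_compact.
(* The box of radius 2 M contains all points y - t v with 0 <= t <= 1. *)
have [||| [c1 c2] _ Hc] := @compact_EVT_min _ R q (A (2 * M) `*` A M).
- exists (0, 0); split=> i; rewrite /= mxE in_itv /=; lra.
- exact: compact_setX.
- exact: continuous_subspaceT.
exists `|q (c1, c2)| => // y v e yM vM /andP[e0 e1].
have dz (t : R) : vder (fun s : R => y + s *: - v) (- v) t := vder_line y (- v) t.
pose G (t : R) := dotv (grad V (y + t *: - v)) (- v).
have dG (t : R) : is_derive t 1 G (q (y + t *: - v, - v)).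
  have := dotv_derive (grad_along (dz t)) (vder_cst (- v) t).
  by rewrite dotv0 addr0.
have qge (t : R) : 0 <= t <= 1 -> - `|q (c1, c2)| <= q (y + t *: - v, - v).
  move=> /andP[t0 t1]; apply: (@le_trans _ _ (q (c1, c2))).
    by rewrite lerNl -normrN ler_norm.
  apply: Hc; rewrite inE; split=> i /=; rewrite ?mxE in_itv /= -ler_norml ?normrN //.
  apply: le_trans (ler_normD _ _) _; rewrite normrM normrN (ger0_norm t0).
  have := yM i; have := vM i; have := ler_piMl (normr_ge0 (v 0 i)) t1; lra.
set B := `|q (c1, c2)|.
have Gge (t : R) : 0 <= t <= 1 -> G 0 - B * t <= G t.
  move=> /andP[t0 t1].
  have hh (s : R) := is_deriveD (dG s) (is_deriveZ B (is_derive_id s 1)).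
  have := is_derive_ge0 t0 (fun s _ => hh s).
  rewrite !fctE /GRing.scale /= mulr1 => h; have : G 0 + B * 0 <= G t + B * t; last by lra.
  apply: h => s /andP[s0 st].
  by have := qge s; rewrite s0 (le_trans st t1) -/B => /(_ isT); lra.
have dVt (t : R) : is_derive t 1 (fun s : R => V (y + s *: - v)) (G t) := V_along (dz t).
have hh (t : R) := is_deriveD (is_deriveB (dVt t) (is_deriveZ (G 0) (is_derive_id t 1)))
  (is_deriveZ (B / 2) (is_deriveX 2 (is_derive_id t 1))).
have := is_derive_ge0 e0 (fun t _ => hh t).
rewrite !fctE /GRing.scale /= !mulr1 => h.
have : V (y + 0 *: - v) - G 0 * 0 + B / 2 * 0 ^+ 2 <=
  V (y + e *: - v) - G 0 * e + B / 2 * e ^+ 2.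
  apply: h => t /andP[t0 te]; rewrite expr1.
  by have := Gge t; rewrite t0 (le_trans te e1) => /(_ isT); lra.
rewrite /G scale0r addr0 dotvNr scalerN.
have := mulr_ge0 (normr_ge0 (q (c1, c2))) (sqr_ge0 e); rewrite -/B; lra.
Qed.

End potential.

(** * Compactness of energy balls *)

Lemma ultra_fmap (T U : Type) (f : T -> U) (F : set_system T) :
  UltraFilter F -> UltraFilter (f @ F).
Proof.
move=> UF; split; first exact: fmap_proper_filter.
move=> G PG FG; apply/seteqP; split => // A GA.
have [//|FC] := in_ultra_setVsetC (f @^-1` A) UF.
have GC : G (~` A) by apply: FG; exact: FC.
by have [x []] := filter_ex (filterI GA GC).
Qed.

Lemma cvg_le_filter (R : realType) (T : Type) (F : set_system T) (FF : ProperFilter F)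
    (a : T -> R) (l c : R) :
  a @ F --> l -> (forall e, 0 < e -> \forall n \near F, a n <= c + e) -> l <= c.
Proof.
move=> /cvgrPdist_lt al ac; apply/ler_addgt0Pl => e e0.
have e2 : 0 < e / 2 by rewrite divr_gt0.
have [n [an]] := filter_ex (filterI (ac _ e2) (al _ e2)).
rewrite ltr_distl => /andP[_]; lra.
Qed.

Lemma holder_cont (R : realType) (N : nat) (y : R -> 'rV[R]_N) (e : R) :
  0 <= e -> (forall s t, dotv (y s - y t) (y s - y t) <= e * `|s - t|) -> continuous y.
Proof.
move=> e0 hy; apply/row_cont => i t; apply/cvgrPdist_lt => d d0.
have h : 0 < d ^+ 2 / (e + 1) by rewrite divr_gt0 ?exprn_gt0 // ltr_wpDl.
have := (@cont_id R t : (fun s => s) @ t --> t)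
  => /cvgrPdist_lt /(_ _ h); apply: filterS => s ts.
rewrite -ltr_sqr ?nnegrE ?normr_ge0 ?(ltW d0) // real_normK ?num_real //.
apply: (@le_lt_trans _ _ (e * `|t - s|)).
  by apply: le_trans (hy t s); have := coord_sqr_le (y t - y s) i; rewrite !mxE.
apply: (@le_lt_trans _ _ ((e + 1) * `|t - s|)).
  by rewrite ler_wpM2r // lerDl.
by rewrite mulrC -ltr_pdivlMr // ltr_wpDl.
Qed.

Section compactness.
Context {R : realType} {N : nat}.
Variable tau : R.
Hypothesis tau0 : 0 < tau.
Variables (F : set_system nat) (UF : UltraFilter F).
Variables (y : nat -> R -> 'rV[R]_N) (e : R).
Hypothesis e0 : 0 <= e.
Hypothesis hy : forall n s t, dotv (y n s - y n t) (y n s - y n t) <= e * `|s - t|.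

(** The Hölder bound against [y n tau = 0] keeps [y n t] in a compact box for fixed t. Along an
    ultrafilter every such sequence converges, so one filter serves all t at once. *)
Lemma holder_limit_ex : (forall n, y n tau = 0) ->
  exists z : R -> 'rV[R]_N, forall t, (fun n => y n t) @ F --> z t.
Proof.
move=> ytau.
suff h t : exists v : 'rV[R]_N, (fun n => y n t) @ F --> v.
  by exists (fun t => sval (cid (h t))) => t; exact: svalP (cid (h t)).
(* The summand 1 ensures m <= m^2, so that |y n t|^2 <= m bounds the coordinates by m. *)
pose m := e * `|t - tau| + 1.
have m1 : 1 <= m by rewrite lerDr mulr_ge0.
pose A := [set v : 'rV[R]_N | forall i, (`[- m, m]%classic : set R) (v ord0 i)].
have cA : compact A.
  by apply: (rV_compact (A := fun=> `[- m, m]%classic)) => _; exact: segment_compact.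
have UG := ultra_fmap (fun n => y n t) UF.
move: cA; rewrite compact_ultra => /(_ _ UG) [|v [_ hv]]; last by exists v.
suff : \forall n \near F, A (y n t) by [].
apply: nearW => n i /=; rewrite in_itv /= -ler_norml.
have m0 : 0 <= m by rewrite (le_trans _ m1).
rewrite -ler_sqr ?nnegrE ?normr_ge0 // real_normK ?num_real //.
apply: (le_trans (coord_sqr_le (y n t) i)).
have := hy n t tau; rewrite ytau subr0 => h; apply: (le_trans h).
have mm : m <= m ^+ 2 by rewrite expr2 ler_peMr.
by apply: le_trans mm; rewrite /m lerDl.
Qed.

Variable z : R -> 'rV[R]_N.
Hypothesis yz : forall t, (fun n => y n t) @ F --> z t.

Let dotv_cvg (x : nat -> 'rV[R]_N) (w : 'rV[R]_N) v :
  x @ F --> w -> (fun n => dotv v (x n)) @ F --> dotv v w.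
Proof.
move=> xw; have cd : continuous (fun p : 'rV[R]_N => dotv v p).
  exact: dotv_cont (cont_cst v) cont_id.
exact: (cvg_comp _ _ xw (cd w)).
Qed.

Lemma limit_holder s t : dotv (z s - z t) (z s - z t) <= e * `|s - t|.
Proof.
have h : (fun n => y n s - y n t) @ F --> z s - z t by apply: cvgB.
have cd : continuous (fun p : 'rV[R]_N => dotv p p) := dotv_cont cont_id cont_id.
have := cvg_comp _ _ h (cd (z s - z t)).
move/cvg_le_filter; apply => d d0; near=> n.
by apply: (le_trans (hy n s t)); rewrite lerDl ltW.
Unshelve. all: by end_near. Qed.

(** The common Hölder modulus turns pointwise convergence into convergence of [y n s] to [z t] as s
    tends to t and n along F jointly; compactness of [0, tau] then makes the convergence of the
    integrands uniform. *)
Lemma itg_limit (h : R * 'rV[R]_N -> R) : continuous h ->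
  (fun n => itg 0 tau (fun t => h (t, y n t))) @ F --> itg 0 tau (fun t => h (t, z t)).
Proof.
move=> ch; have cz := holder_cont e0 limit_holder.
have cy n := holder_cont e0 (hy n).
have chz (x : R -> 'rV[R]_N) : continuous x -> continuous (fun t => h (t, x t)).
  move=> cx; exact: (cont_comp (cont_pair cont_id cx) ch).
apply/cvgrPdist_le => d d0.
pose d1 := d / tau; have d10 : 0 < d1 by rewrite divr_gt0.
have d2 : 0 < d1 / 2 by rewrite divr_gt0.
have main : \forall n \near F, `[0, tau] `<=` [set t | `|h (t, z t) - h (t, y n t)| < d1].
  apply: (compact_near_coveringP _).1; first exact: segment_compact.
  move=> t _.
  have c1 : (fun p : R * nat => (p.1, y p.2 p.1)) @ (nbhs t, F) --> (t, z t).
    have a1 : (fun p : R * nat => p.1) @ (nbhs t, F) --> t by exact: cvg_fst.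
    suff a2 : (fun p : R * nat => y p.2 p.1) @ (nbhs t, F) --> z t by exact: (cvg_pair a1 a2).
    apply: row_cvg => i; apply/cvgrPdist_lt => r r0.
    have r2 : 0 < r / 2 by rewrite divr_gt0.
    have n1 : \forall n \near F, `|z t 0 i - y n t 0 i| < r / 2.
      have := cvg_comp _ _ (@yz t) (@coord_continuous _ _ _ 0 i (z t)).
      by move/cvgrPdist_lt; apply.
    have r3 : 0 < (r / 2) ^+ 2 / (e + 1) by rewrite divr_gt0 ?exprn_gt0 // ltr_wpDl.
    have n2 : \forall s \near t, `|t - s| < (r / 2) ^+ 2 / (e + 1).
      by have := (@cont_id R t : (fun s => s) @ t --> t) => /cvgrPdist_lt; apply.
    exists ([set s | `|t - s| < (r / 2) ^+ 2 / (e + 1)], [set n | `|z t 0 i - y n t 0 i| <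
      r / 2]) => //.
    move=> [s n] [/= hs hn].
    have hh : `|y n t 0 i - y n s 0 i| < r / 2.
      rewrite -ltr_sqr ?nnegrE ?normr_ge0 ?(ltW r2) // real_normK ?num_real //.
      apply: (@le_lt_trans _ _ ((e + 1) * `|t - s|));
        last by rewrite mulrC -ltr_pdivlMr // ltr_wpDl.
      apply: (@le_trans _ _ (e * `|t - s|)); last by rewrite ler_wpM2r // lerDl.
      by apply: le_trans (hy n t s); have := coord_sqr_le (y n t - y n s) i; rewrite !mxE.
    rewrite [ltRHS]splitr (_ : _ - _ = (z t 0 i - y n t 0 i) + (y n t 0 i - y n s 0 i));
      last by ring.
    by apply: le_lt_trans (ler_normD _ _) _; rewrite ltrD.
  have c2 := cvg_comp _ _ c1 (ch (t, z t)).
  have n1 := (cvgrPdist_lt _ _).1 c2 _ d2.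
  have n2 := (cvgrPdist_lt _ _).1 (chz _ cz t) _ d2.
  near=> p.
  have e1 : `|h (t, z t) - h (p.1, y p.2 p.1)| < d1 / 2 by near: p; exact: n1.
  have e2 : `|h (t, z t) - h (p.1, z p.1)| < d1 / 2.
    near: p; exists ([set s | `|h (t, z t) - h (s, z s)| < d1 / 2], setT).
      by split; [exact: n2|exact: filterT].
    by move=> q [].
  rewrite /= [ltRHS]splitr (_ : _ - _ =
    (h (t, z t) - h (p.1, y p.2 p.1)) - (h (t, z t) - h (p.1, z p.1))); last by ring.
  by apply: le_lt_trans (ler_normB _ _) _; rewrite ltrD.
near=> n.
rewrite -itgB; [|exact: chz|exact: chz].
have -> : d = d1 * (tau - 0) by rewrite subr0 divfK // gt_eqF.
apply: itg_abs_le; [|exact: ltW|].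
  by apply: cont_B; exact: chz.
have := near main n; move=> /(_ _) hn t /andP[t0 tt]; apply/ltW/hn => //.
by rewrite /= in_itv /= t0.
Unshelve. all: by end_near. Qed.

Lemma limit_energy : (forall n, energy_le tau (y n) 1) -> energy_le tau z 1.
Proof.
move=> Ey; have cz := holder_cont e0 limit_holder.
split=> // [|f v s t cf s0 st tt].
  have := @yz tau; rewrite (_ : (fun n => y n tau) = (fun=> 0)).
    by move/cvg_lim => <- //; rewrite lim_cst.
  by apply/funext => n; case: (Ey n).
set Q := ip tau f _ + _ + _.
have h1 : (fun n => ip tau f (y n)) @ F --> ip tau f z.
  apply: (@itg_limit (fun p => dotv (f p.1) p.2)).
  apply: dotv_cont; last exact: cont_snd.
  exact: cont_comp cont_fst cf.
have h2 : (fun n => dotv v (y n s - y n t)) @ F --> dotv v (z s - z t).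
  by apply: dotv_cvg; apply: cvgB.
have h3 : (fun n => 2 * ip tau f (y n) + 2 * dotv v (y n s - y n t) - Q) @ F -->
    2 * ip tau f z + 2 * dotv v (z s - z t) - Q.
  apply: cvgB; last exact: cvg_cst.
  by apply: cvgD; apply: cvgM => //; exact: cvg_cst.
move: h3 => /cvg_le_filter; apply => d d0; near=> n.
have [_ _ H] := Ey n; apply: le_trans (H f v s t cf s0 st tt) _.
by rewrite lerDl ltW.
Unshelve. all: by end_near. Qed.

End compactness.

(** * Existence of a minimizer *)

Section minimizer.
Context {R : realType} {N : nat}.
Variables (tau : R) (V : 'rV[R]_N -> R).
Hypothesis tau0 : 0 < tau.
Hypothesis cV : continuous V.
Implicit Types x y : R -> 'rV[R]_N.

Definition pot x : R := itg 0 tau (fun t => V (x t)).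

(* With [energy_le tau x 1], bounds the action on the whole ray through x. *)
Definition fiber_le x (c : R) :=
  forall s, 0 <= s -> s ^+ 2 / 2 - pot (fun t => s *: x t) <= c.

Lemma pot_eq x y : continuous x -> continuous y ->
  (forall t, 0 <= t <= tau -> x t = y t) -> pot x = pot y.
Proof.
move=> cx cy xy; apply: itg_eq; [exact: cont_comp cx cV|exact: cont_comp cy cV|exact: ltW|].
by move=> t /xy ->.
Qed.

Lemma energy_le_clamp x : energy_le tau x 1 -> exists y : R -> 'rV[R]_N,
  [/\ energy_le tau y 1, forall s t, dotv (y s - y t) (y s - y t) <= 1 * `|s - t|
    & forall c, fiber_le x c -> fiber_le y c].
Proof.
move=> Ex; have [Ey hy] := energy_clamp tau0 Ex.
exists (fun t => x (Num.max 0 (Num.min t tau))); split=> // c xc s s0.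
rewrite (_ : pot _ = pot (fun t => s *: x t)); first exact: xc.
have [cx _ _] := Ex; have [cy _ _] := Ey.
apply: pot_eq => [||t /andP[t0 tt]]; try exact: cont_Z (cont_cst _) _.
by rewrite min_l // max_r.
Qed.

Lemma energy_ip_gt0 x e t : energy_le tau x e -> 0 <= t <= tau -> x t != 0 ->
  0 < ip tau x x.
Proof.
move=> Ex t01 xt0; have [cx xtau _] := Ex.
rewrite lt_neqAle ip_ge0 ?(ltW tau0) // andbT; apply/negP => /eqP/esym I0.
have z u : 0 < u < tau -> x u = 0.
  move=> u01; apply: dotv_eq0.
  apply: (itg_eq0_ge0 (f := fun u => dotv (x u) (x u)) _ _ I0 u01).
    exact: dotv_cont.
  by move=> *; exact: dotv_ge0.
have e0 := energy_ge0 tau0 Ex.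
suff x0 : x 0 = 0.
  move: t01 xt0 => /andP[]; rewrite le_eqVlt => /predU1P[<-|t0]; first by rewrite x0 eqxx.
  by rewrite le_eqVlt => /predU1P[->|tt]; rewrite ?xtau ?eqxx // z ?t0 // eqxx.
apply: dotv_eq0; apply/eqP; rewrite eq_le dotv_ge0 andbT; apply/ler_addgt0Pl => d d0.
(* Continuity at 0 is quantified by [energy_holder]: u lies in (0, tau), where x vanishes, and (e +
   1) u <= d. *)
pose u := Num.min (tau / 2) (d / (e + 1)).
have e1 : 0 < e + 1 by rewrite ltr_wpDl.
have u0 : 0 < u by rewrite lt_min !divr_gt0.
have utau : u < tau by rewrite gt_min; rewrite ltr_pdivrMr // ltr_pMr // ltr1n.
have := energy_holder Ex (lexx 0) (ltW u0) (ltW utau).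
rewrite (z u) ?u0 // !subr0 => h; rewrite addr0; apply: le_trans h _.
apply: (@le_trans _ _ ((e + 1) * u)); first by rewrite ler_wpM2r ?(ltW u0) // lerDl.
by rewrite mulrC -ler_pdivlMr // ge_min lexx orbT.
Qed.

Hypothesis Vsup : forall A : R, 0 <= A ->
  exists2 C, 0 <= C & forall y : 'rV[R]_N, A * dotv y y - C <= V y.
Hypothesis V_0 : V 0 = 0.

Lemma pot_superquadratic x (A : R) : continuous x -> 0 <= A ->
  exists2 C, 0 <= C & forall s, A * s ^+ 2 * ip tau x x - C <= pot (fun t => s *: x t).
Proof.
move=> cx A0; have [C C0 HC] := Vsup A0; exists (C * tau); first by rewrite mulr_ge0 // ltW.
move=> s; have cs : continuous (fun t => s *: x t) := cont_Z (cont_cst s) cx.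
have cxx : continuous (fun t => dotv (x t) (x t)) := dotv_cont cx cx.
have ck : continuous (fun t => A * s ^+ 2 * dotv (x t) (x t)) := cont_M (cont_cst _) cxx.
have -> : A * s ^+ 2 * ip tau x x - C * tau =
  itg 0 tau (fun t => A * s ^+ 2 * dotv (x t) (x t) - C).
  by rewrite (itgB _ _ ck (cont_cst C)) (itgZ _ _ _ cxx) itg_cst subr0.
apply: itg_le; [exact: cont_B ck (cont_cst C)|exact: cont_comp cs cV|exact: ltW|].
move=> t _; apply: le_trans (HC _); rewrite dotvZl dotvZr le_eqVlt; apply/orP; left;
  apply/eqP; ring.
Qed.

Lemma fiber_ex x : continuous x -> 0 < ip tau x x -> exists c, fiber_le x c.
Proof.
(* This coefficient makes A s^2 <x, x> equal to s^2 / 2, which cancels the kinetic term. *)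
move=> cx I0; have A0 : 0 <= (2 * ip tau x x)^-1 by rewrite invr_ge0 mulr_ge0 // ltW.
have [C C0 HC] := pot_superquadratic cx A0; exists C => s _.
have := HC s; rewrite (_ : _ * _ * _ = s ^+ 2 / 2); last by field; rewrite gt_eqF.
lra.
Qed.

Hypothesis hN : (1 <= N)%N.

(** The witness is a parabola, K of a constant vector, rescaled; at a = tau [energy_trunc] provides
    its energy bound. *)
Lemma energy_nontrivial :
  exists2 x : R -> 'rV[R]_N, energy_le tau x 1 & 0 < ip tau x x.
Proof.
pose c : 'rV[R]_N := const_mx 1.
have cc : continuous (fun _ : R => c) by exact: cont_cst.
have vE : vprim (fun=> c) = (fun r => r *: c).
  by apply/funext => r; apply/rowP => i; rewrite !mxE itg_cst subr0 mulrC.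
have gE : green tau (fun=> c) 0 = (tau ^+ 2 / 2) *: c.
  apply/rowP => i; rewrite /green vE !mxE.
  have d (t : R) : is_derive t 1 (2^-1 *: (@id R ^+ 2)) t.
    apply: (@is_derive_eq _ _ _ _ _ _ _ _ (is_deriveZ 2^-1 (is_deriveX 2 (is_derive_id t 1)))).
    by rewrite /GRing.scale /= expr1 mulr1 mulrA mulVf ?mul1r // pnatr_eq0.
  rewrite (_ : (fun r => _) = id); last by apply/funext => r; rewrite !mxE mulr1.
  by rewrite (itgE _ _ d cont_id) !fctE /GRing.scale /= mulr1 expr0n /= mulr0 subr0 mulrC.
have hta : 0 <= tau <= tau by rewrite lexx ltW.
have Ey := energy_trunc cc hta (green_tau tau (fun=> c)).
set e := ip _ _ _ in Ey; have e0 := energy_ge0 tau0 Ey.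
set y := (fun t => green tau _ _) in Ey.
have y0 : y 0 != 0.
  rewrite /y min_l ?ltW // gE scaler_eq0 negb_or mulf_neq0 ?expf_neq0 ?gt_eqF ?invr_gt0 //=.
  apply/eqP => /rowP /(_ (Ordinal hN)); rewrite !mxE => /eqP; exact/negP/oner_neq0.
have yy : 0 < ip tau y y by apply: (energy_ip_gt0 Ey (t := 0)) => //; rewrite lexx ltW.
(* Dividing by the root of e + 1 brings the bound below 1 with only e >= 0 at hand. *)
have k0 : 0 < Num.sqrt (e + 1) by rewrite sqrtr_gt0 ltr_wpDl.
have kn0 : (Num.sqrt (e + 1))^-1 != 0 by rewrite invr_eq0 gt_eqF.
exists (fun t => (Num.sqrt (e + 1))^-1 *: y t).
  have := energyZ kn0 Ey; rewrite exprVn sqr_sqrtr; last by rewrite addr_ge0.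
  case=> a b H; split=> // f v s t cf s0 st tt; apply: le_trans (H f v s t cf s0 st tt) _.
  by rewrite mulrC ler_pdivrMr ?mul1r ?lerDl // ltr_wpDl.
have [cy _ _] := Ey.
rewrite ipZl ?ipZr //; last exact: cont_Z (cont_cst _) cy.
by rewrite !mulr_gt0 // invr_gt0.
Qed.

(** For each fixed s the inequality s^2 / 2 - [pot] (s y_n) <= c0 + 1 / (n + 1) passes to the limit,
    because the potential term converges. The limit is not zero: on the zero ray s^2 / 2 is
    unbounded. *)
Lemma minimizer_ex : exists (c0 : R) (x : R -> 'rV[R]_N),
  [/\ energy_le tau x 1, fiber_le x c0, 0 < ip tau x x &
      forall y c, energy_le tau y 1 -> fiber_le y c -> c0 <= c].
Proof.
(* S collects upper bounds for the rays rather than their maxima; the infimum is the same. *)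
pose S := [set c | exists2 x : R -> 'rV[R]_N, energy_le tau x 1 & fiber_le x c].
have pot0 x : pot (fun t => 0 *: x t) = 0.
  rewrite /pot (_ : (fun t => _) = (fun=> 0)); first by rewrite itg_cst mul0r.
  by apply/funext => t; rewrite scale0r V_0.
have Slb : lbound S 0.
  move=> c [x _ /(_ 0 (lexx 0))]; rewrite pot0 expr0n /= mul0r subr0; exact.
have S0 : S !=set0.
  have [x Ex x0] := energy_nontrivial; have [cx _ _] := Ex.
  by have [c xc] := fiber_ex cx x0; exists c; exists x.
have hS : has_inf S by split => //; exists 0.
pose c0 := inf S.
have lb y c : energy_le tau y 1 -> fiber_le y c -> c0 <= c.
  by move=> Ey yc; apply: inf_lbound; [exact: hS.2|exists y].
have seq n : exists y : R -> 'rV[R]_N, [/\ energy_le tau y 1,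
    forall s t, dotv (y s - y t) (y s - y t) <= 1 * `|s - t| & fiber_le y (c0 + n.+1%:R^-1)].
  have n0 : (0 : R) < n.+1%:R^-1 by rewrite invr_gt0 ltr0n.
  have [c [x Ex xc] cc] := inf_adherent n0 hS.
  have [y [Ey hy yc]] := energy_le_clamp Ex; exists y; split=> // s s0.
  by apply: le_trans (yc _ xc s s0) (ltW cc).
have [y hy] := choice seq.
have [F [UF FN]] := ultraFilterLemma (F := \oo) _.
have Hy n : forall s t, dotv (y n s - y n t) (y n s - y n t) <= 1 * `|s - t| by have [] :=
  hy n.
have ytau n : y n tau = 0 by have [[]] := hy n.
have [z yz] := holder_limit_ex UF ler01 Hy ytau.
have Ez : energy_le tau z 1.
  by apply: (limit_energy tau0 UF ler01 Hy yz) => n; have [] := hy n.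
have [cz ztau _] := Ez.
have fz : fiber_le z c0.
  move=> s s0.
  have ch : continuous (fun p : R * 'rV[R]_N => V (s *: p.2)).
    exact: cont_comp (cont_Z (cont_cst s) cont_snd) cV.
  have := itg_limit tau0 UF ler01 Hy yz ch.
  move=> /(cvgB (cvg_cst (s ^+ 2 / 2))) /cvg_le_filter; apply => d d0.
  have : \forall n \near F, n.+1%:R^-1 <= d.
    by apply: FN; near=> n; apply/ltW; near: n; exact: near_infty_natSinv_lt (PosNum d0).
  apply: filterS => n nd; have [_ _ /(_ s s0) h] := hy n.
  by apply: le_trans h _; rewrite lerD2l.
exists c0, z; split => //.
rewrite lt_neqAle ip_ge0 ?(ltW tau0) // andbT; apply/negP => /eqP I0.
have c0_0 : 0 <= c0 by apply: lb_le_inf.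
have z0 t : 0 <= t <= tau -> z t = 0.
  move=> t01; apply/eqP/negPn/negP => zt.
  by have := energy_ip_gt0 Ez t01 zt; rewrite -I0 ltxx.
(* With c0 >= 0, s = c0 + 2 gives s^2 / 2 > c0, against [fiber_le]. *)
have := fz (c0 + 1 + 1) _; rewrite (_ : pot _ = 0).
  rewrite subr0 => h; have : (c0 + 1 + 1) ^+ 2 / 2 <= c0 by apply: h; lra.
  nra.
rewrite -(pot0 z); apply: pot_eq;
  [exact: cont_Z (cont_cst _) cz|exact: cont_Z (cont_cst _) cz|].
by move=> t /z0 ->; rewrite !scaler0.
Unshelve. all: by end_near. Qed.

End minimizer.

(** * Criticality of the minimizer *)

Lemma green_param_cont (R : realType) (N : nat) (tau : R) (P : topologicalType)
    (h : P -> R -> 'rV[R]_N) :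
  continuous (fun z : P * R => h z.1 z.2) ->
  continuous (fun z : P * R => green tau (h z.1) z.2).
Proof.
move=> /row_cont ch; apply/row_cont => i.
have c1 : continuous (fun z : P * R => vprim (h z.1) z.2 0 i).
  rewrite (_ : (fun z => _) = (fun z : P * R => itg 0 z.2 (fun r => h z.1 r 0 i))).
    exact: (itg_param_cont (h := fun p r => h p r 0 i) (ch i)).
  by apply/funext => z; rewrite mxE.
have c2 := itg_param_cont (h := fun p r => vprim (h p) r 0 i) c1.
have c3 : continuous (fun z : P * R => (z.1, tau)) := cont_pair cont_fst (cont_cst tau).
have c4 := cont_B (cont_comp c3 c2) c2.
rewrite (_ : (fun z => _) = (fun z : P * R => itg 0 tau (fun r => vprim (h z.1) r 0 i)
   - itg 0 z.2 (fun r => vprim (h z.1) r 0 i))) //.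
by apply/funext => z; rewrite mxE /itg; ring.
Qed.

Lemma rectangle_bound (R : realType) (N : nat) (S tau : R) (h : R * R -> 'rV[R]_N) :
  0 <= S -> 0 <= tau -> continuous h ->
  exists2 M, 0 <= M & forall s t, 0 <= s <= S -> 0 <= t <= tau ->
    forall i, `|h (s, t) 0 i| <= M.
Proof.
move=> S0 t0 ch.
have cA : compact (`[0, S] `*` `[0, tau] : set (R * R)).
  by apply: compact_setX; exact: segment_compact.
have [||c _ Hc] := compact_EVT_max (f := fun p => dotv (h p) (h p)) _ cA.
- by exists (0, 0); split; rewrite /= in_itv /= lexx.
- by apply: continuous_subspaceT; exact: dotv_cont.
set B := dotv _ _ in Hc; have B0 : 0 <= B := dotv_ge0 _.
exists (B + 1) => [|s t sS tt i]; first by rewrite addr_ge0.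
rewrite -ler_sqr ?nnegrE ?normr_ge0 ?addr_ge0 // real_normK ?num_real //.
apply: le_trans (coord_sqr_le _ i) _; apply: (@le_trans _ _ B).
  by apply: Hc; rewrite inE; split; rewrite /= in_itv.
nra.
Qed.

Lemma seg_ivt (R : realType) (f : R -> R) (a b : R) : a <= b -> continuous f ->
  0 <= f a -> f b <= 0 -> exists2 c, a <= c <= b & f c = 0.
Proof.
move=> ab cf fa fb.
have [||c cab fc] := IVT (f := f) (v := 0) ab.
- exact: continuous_subspaceT.
- by rewrite ge_min fb orbT /= le_max fa.
- by exists c => //; move: cab; rewrite in_itv.
Qed.

Section critical.
Context {R : realType} {N : nat}.
Variables (tau : R) (V : 'rV[R]_N -> R).
Hypothesis tau0 : 0 < tau.
Hypothesis cV : continuous V.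
Hypothesis cG : continuous (grad V).
Hypothesis Vge0 : forall y, 0 <= V y.
Hypothesis V_0 : V 0 = 0.
Hypothesis Vray : forall (y : 'rV[R]_N) (s : R), 0 <= s ->
  V y + (s ^+ 2 - 1) / 2 * dotv (grad V y) y <= V (s *: y).
Hypothesis Vsmall : forall e : R, 0 < e -> exists2 r, 0 < r &
  forall y, dotv y y <= r -> y != 0 -> `|V y| <= e * dotv y y.
Hypothesis Vsup : forall A : R, 0 <= A ->
  exists2 C, 0 <= C & forall y : 'rV[R]_N, A * dotv y y - C <= V y.
Hypothesis Vtaylor : forall M : R, 0 <= M -> exists2 C, 0 <= C &
  forall (y v : 'rV[R]_N) (e : R), (forall i, `|y 0 i| <= M) -> (forall i, `|v 0 i| <= M) ->
    0 <= e <= 1 -> V y - e * dotv (grad V y) v - C * e ^+ 2 <= V (y - e *: v).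
Implicit Types x y : R -> 'rV[R]_N.

Let gradV y := fun t : R => grad V (y t).

(** Integrating [V_ray] gives [pot] (r y) >= [pot] y + (r^2 - 1) / 2 e on a Nehari point, so r^2 e /
    2 - [pot] (r y) <= e / 2 - [pot] y. With the minimality of c0 this yields c0 <= e / 2 - [pot]
    y. *)
Lemma nehari_le y e : energy_le tau y e -> 0 < e -> ip tau (gradV y) y = e ->
  energy_le tau (fun t => (Num.sqrt e)^-1 *: y t) 1 /\
  fiber_le tau V (fun t => (Num.sqrt e)^-1 *: y t) (e / 2 - pot tau V y).
Proof.
move=> Ey e0 Ne; have k0 : 0 < Num.sqrt e by rewrite sqrtr_gt0.
have ke : (Num.sqrt e) ^+ 2 = e by rewrite sqr_sqrtr // ltW.
have [cy _ _] := Ey; have cgy : continuous (gradV y) := cont_comp cy cG.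
split.
  have kn0 : (Num.sqrt e)^-1 != 0 by rewrite invr_eq0 gt_eqF.
  by have := energyZ kn0 Ey; rewrite exprVn ke mulVf ?gt_eqF.
move=> s s0; set r := s / Num.sqrt e.
have r0 : 0 <= r by rewrite divr_ge0 // ltW.
rewrite (_ : (fun t => _) = (fun t => r *: y t)); last by apply/funext => t; rewrite scalerA.
have -> : s ^+ 2 = r ^+ 2 * e by rewrite /r -{2}ke; field; rewrite gt_eqF.
have cd : continuous (fun t => dotv (gradV y t) (y t)) := dotv_cont cgy cy.
have cVy : continuous (fun t => V (y t)) := cont_comp cy cV.
have ck := cont_M (cont_cst ((r ^+ 2 - 1) / 2)) cd.
have : pot tau V y + (r ^+ 2 - 1) / 2 * ip tau (gradV y) y <= pot tau V (fun t => r *: y t).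
  rewrite /pot /ip -(itgZ _ _ _ cd) -(itgD _ _ cVy ck); apply: itg_le.
  - exact: cont_D cVy ck.
  - exact: cont_comp (cont_Z (cont_cst r) cy) cV.
  - exact: ltW.
  - by move=> t _; exact: Vray.
rewrite Ne; lra.
Qed.

Variables (c0 : R) (x : R -> 'rV[R]_N).
Hypothesis min0 : forall y c, energy_le tau y 1 -> fiber_le tau V y c -> c0 <= c.
Hypothesis Ex : energy_le tau x 1.
Hypothesis xc0 : fiber_le tau V x c0.
Hypothesis x0 : 0 < ip tau x x.

Let cx : continuous x. Proof. by case: Ex. Qed.

Let g (s : R) := gradV (fun t => s *: x t).
Let Kg (s : R) := green tau (g s).
Let a (s : R) := ip tau (g s) x.
Let b (s : R) := ip tau (g s) (Kg s).
(* [gam (e, s)] is the point s of the ray pushed down by e along the gradient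
   [G s] of the action, [en] the energy bound it inherits from x, [D] that of
   [G s]; [Ne] vanishes on the Nehari set. *)
Let G (s : R) := fun t => s *: x t - Kg s t.
Let gam (z : R * R) := fun t => z.2 *: x t - z.1 *: G z.2 t.
Let en (z : R * R) := (1 - z.1) ^+ 2 * z.2 ^+ 2 + 2 * z.1 * (1 - z.1) * z.2 * a z.2 + z.1
  ^+ 2 * b z.2.
Let D (s : R) := s ^+ 2 - 2 * s * a s + b s.
Let Ne (z : R * R) := en z - ip tau (gradV (gam z)) (gam z).

Let csx : continuous (fun z : R * R => z.1 *: x z.2).
Proof. exact: cont_Z cont_fst (cont_comp cont_snd cx). Qed.

Let cg2 : continuous (fun z : R * R => g z.1 z.2).
Proof. exact: cont_comp csx cG. Qed.

Let cg s : continuous (g s).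
Proof. exact: cont_comp (cont_Z (cont_cst s) cx) cG. Qed.

Let cKg2 : continuous (fun z : R * R => Kg z.1 z.2).
Proof. exact: green_param_cont cg2. Qed.

Let cKg s : continuous (Kg s).
Proof. exact: green_cont (@cg s). Qed.

Let ca : continuous a.
Proof.
apply: (itg_param_cont_ab (h := fun s t => dotv (g s t) (x t))).
exact: dotv_cont cg2 (cont_comp cont_snd cx).
Qed.

Let cb : continuous b.
Proof.
apply: (itg_param_cont_ab (h := fun s t => dotv (g s t) (Kg s t))).
exact: dotv_cont cg2 cKg2.
Qed.

Let cG2 : continuous (fun z : R * R => G z.1 z.2).
Proof. exact: cont_B csx cKg2. Qed.

Let cen : continuous en.
Proof.
have c1 : continuous (fun z : R * R => z.1) := cont_fst.
have c2 : continuous (fun z : R * R => z.2) := cont_snd.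
have c1e := cont_B (cont_cst (A := (R * R)%type) (1 : R)) c1.
have csq (h : R * R -> R) : continuous h -> continuous (fun z => h z ^+ 2).
  by move=> ch; have := cont_M ch ch; under eq_fun do rewrite -expr2.
apply: cont_D; last exact: cont_M (csq _ c1) (cont_comp c2 cb).
apply: cont_D; first exact: cont_M (csq _ c1e) (csq _ c2).
have c12 := cont_M (cont_M (cont_M (cont_cst (2 : R)) c1) c1e) c2.
exact: cont_M c12 (cont_comp c2 ca).
Qed.

Let cNe : continuous Ne.
Proof.
have c1 : continuous (fun z : (R * R) * R => z.1.1) := cont_comp cont_fst cont_fst.
have c2 : continuous (fun z : (R * R) * R => z.1.2) := cont_comp cont_fst cont_snd.
have c3 : continuous (fun z : (R * R) * R => z.2) := cont_snd.
have cga : continuous (fun z : (R * R) * R => gam z.1 z.2).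
  exact: cont_B (cont_Z c2 (cont_comp c3 cx)) (cont_Z c1 (cont_comp (cont_pair c2 c3) cG2)).
apply: cont_B cen _.
apply: (itg_param_cont_ab (h := fun z t => dotv (gradV (gam z) t) (gam z t))).
exact: dotv_cont (cont_comp cga cG) cga.
Qed.

Let cD : continuous D.
Proof.
have csq : continuous (fun s : R => s ^+ 2).
  by have := cont_M (@cont_id R) (@cont_id R); under eq_fun do rewrite -expr2.
apply: cont_D cb; apply: cont_B csq _.
exact: cont_M (cont_M (cont_cst (2 : R)) cont_id) ca.
Qed.

Let energy_comb (k l s : R) : k != 0 ->
  energy_le tau (fun t => k *: x t + l *: Kg s t) (k ^+ 2 + 2 * k * l * a s + l ^+ 2 * b s).
Proof.
move=> k0; have Ek := energyZ k0 Ex; rewrite mulr1 in Ek.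
have clg : continuous (fun t => l *: g s t) := cont_Z (cont_cst l) (@cg s).
have ckx : continuous (fun t => k *: x t) := cont_Z (cont_cst k) cx.
have clK : continuous (fun t => l *: Kg s t) := cont_Z (cont_cst l) (@cKg s).
have E1 : ip tau (fun t => l *: g s t) (fun t => k *: x t) = l * (k * a s).
  by rewrite (ipZl _ _ (@cg s) ckx) (ipZr _ _ cx (@cg s)).
have E2 : ip tau (fun t => l *: g s t) (fun t => l *: Kg s t) = l * (l * b s).
  by rewrite (ipZl _ _ (@cg s) clK) (ipZr _ _ (@cKg s) (@cg s)).
have := energyD_green Ek clg.
rewrite (greenZ _ _ (@cg s)) E1 E2 => h.
have -> // : k ^+ 2 + 2 * k * l * a s + l ^+ 2 * b s =
  k ^+ 2 + 2 * (l * (k * a s)) + l * (l * b s).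
by ring.
Qed.

Let energy_gam (z : R * R) : z.1 < 1 -> 0 < z.2 -> energy_le tau (gam z) (en z).
Proof.
case: z => e s /= e1 s0.
have := energy_comb (k := (1 - e) * s) e s; rewrite mulf_neq0 ?gt_eqF ?subr_gt0 // => /(_ isT).
rewrite (_ : (fun t => _) = gam (e, s)).
  by rewrite (_ : _ + _ + _ = en (e, s)) // /en /=; ring.
by apply/funext => t; rewrite /gam /G /= scalerBr opprB addrCA scalerA addrC mulrBl mul1r
  scalerBl.
Qed.

Let energy_G s : 0 < s -> energy_le tau (G s) (D s).
Proof.
move=> s0; have := energy_comb (k := s) (-1) s; rewrite gt_eqF // => /(_ isT).
rewrite (_ : (fun t => _) = G s); last by apply/funext => t; rewrite scaleN1r.
by rewrite (_ : _ + _ + _ = D s) // /D; ring.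
Qed.

(** At the Nehari point [gam (e, s)], minimality gives c0 <= en / 2 - [pot] (gam), while s^2 / 2 -
    [pot] (s x) <= c0. By [V_taylor] the potentials differ by at most e (s a - b) + C tau e^2, and
    en / 2 = s^2 / 2 - e s^2 + e s a + e^2 D / 2. Together e D <= e^2 (D / 2 + C tau); since e D <=
    D, the term in D on the right is absorbed. *)
Let D_small (S : R) : 0 <= S -> exists2 C, 0 <= C & forall e s,
  0 < e < 1 -> 0 < s <= S -> 0 < en (e, s) -> Ne (e, s) = 0 -> D s <= C * e.
Proof.
move=> S0; have t0 := ltW tau0.
have [M1 M10 HM1] := rectangle_bound S0 t0 csx.
have [M2 M20 HM2] := rectangle_bound S0 t0 cG2.
have [C C0 HC] := Vtaylor (addr_ge0 M10 M20).
exists (2 * (C * tau)); first by rewrite !mulr_ge0.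
move=> e s /andP[e0 e1] /andP[s0 sS] en0 Nes.
have Eg := energy_gam (z := (e, s)) e1 s0.
have Neh : ip tau (gradV (gam (e, s))) (gam (e, s)) = en (e, s).
  by move: Nes; rewrite /Ne; lra.
have [E1 F1] := nehari_le Eg en0 Neh.
have c0J := min0 E1 F1.
have cGs : continuous (G s) := cont_B (cont_Z (cont_cst s) cx) (@cKg s).
have csxs : continuous (fun t => s *: x t) := cont_Z (cont_cst s) cx.
have cVs : continuous (fun t => V (s *: x t)) := cont_comp csxs cV.
have cd : continuous (fun t => dotv (g s t) (G s t)) := dotv_cont (@cg s) cGs.
have ced := cont_M (cont_cst e) cd.
have cbd := cont_B (cont_B cVs ced) (cont_cst (C * e ^+ 2)).
have pg : pot tau V (fun t => s *: x t) - e * ip tau (g s) (G s) - C * e ^+ 2 * tau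
   <= pot tau V (gam (e, s)).
  rewrite /ip /pot -(itgZ _ _ _ cd) -[X in _ - X <=
    _](_ : itg 0 tau (fun=> C * e ^+ 2) = _); last first.
    by rewrite itg_cst subr0.
  rewrite -(itgB _ _ cVs ced) -(itgB _ _ (cont_B cVs ced) (cont_cst _)); apply: itg_le => //.
    have [cga _ _] := Eg; exact: cont_comp cga cV.
  move=> t t01; have sS' : 0 <= s <= S by rewrite ltW.
  apply: HC; last by rewrite !ltW.
    by move=> i; apply: le_trans (HM1 s t sS' t01 i) _; rewrite lerDl.
  by move=> i; apply: le_trans (HM2 s t sS' t01 i) _; rewrite lerDr.
have ipG : ip tau (g s) (G s) = s * a s - b s.
  by rewrite (ipBr _ csxs (@cKg s) (@cg s)) (ipZr _ _ cx (@cg s)).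
have h1 := xc0 (ltW s0).
have D0 := energy_ge0 tau0 (energy_G s0).
rewrite ipG in pg.
have k1 : e * D s <= e * (e * (D s / 2 + C * tau)).
  rewrite /D; move: c0J; rewrite /en /=; lra.
rewrite ler_pM2l // in k1.
have k2 : 0 <= (1 - e) * D s by rewrite mulr_ge0 // subr_ge0 ltW.
by move: k1 k2; move: (D s) => Ds; lra.
Qed.

(** With y = d x, [V_ray] at ratio 2 and V >= 0 give V'(y).y <= 2 / 3 V(2 y), and (V1) makes V(2 y)
    quadratically small. The constants come from |x|^2 <= tau: d <= r / (4 tau) and d <= 1 give |2 d
    x|^2 <= r, and the factor 1 / (4 tau^2) leaves an integral of at most 2 / 3 d^2 < d^2. *)
Let start : exists2 d, 0 < d <= 1 & 0 < Ne (0, d).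
Proof.
have e0 : 0 < (4 * tau ^+ 2)^-1 by rewrite invr_gt0 mulr_gt0 // exprn_gt0.
have [r r0 Hr] := Vsmall e0.
pose d := Num.min 1 (r / (4 * tau)).
have t4 : 0 < 4 * tau by rewrite mulr_gt0.
have d0 : 0 < d by rewrite lt_min ltr01 divr_gt0.
have d1 : d <= 1 by rewrite ge_min lexx.
exists d; first by rewrite d0.
rewrite /Ne /en /gam /= subr0 expr1n expr0n /= !(mulr0, mul0r, mul1r, addr0).
rewrite (_ : (fun t => _) = (fun t => d *: x t));
  last by apply/funext => t; rewrite scale0r subr0.
have [_ xtau _] := Ex.
have xx t : 0 <= t <= tau -> dotv (x t) (x t) <= tau.
  move=> /andP[t0 tt]; have := energy_holder Ex t0 tt (lexx tau); rewrite xtau subr0 mul1r.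
  by move=> h; apply: le_trans h _; lra.
have bound t : 0 <= t <= tau -> dotv (grad V (d *: x t)) (d *: x t) <= 2 / 3 * d ^+ 2 / tau.
  move=> t01.
  have h1 : dotv (grad V (d *: x t)) (d *: x t) <= 2 / 3 * V (2 *: (d *: x t)).
    by have := @Vray (d *: x t) 2 (ler0n _ _); have := Vge0 (d *: x t); lra.
  have h2 : V (2 *: (d *: x t)) <= (4 * tau ^+ 2)^-1 * (4 * d ^+ 2 * dotv (x t) (x t)).
    have [y0|y0] := eqVneq (2 *: (d *: x t)) 0.
      by rewrite y0 V_0 mulr_ge0 ?(ltW e0) // mulr_ge0 ?dotv_ge0 // mulr_ge0 ?sqr_ge0.
    have E : dotv (2 *: (d *: x t)) (2 *: (d *: x t)) = 4 * d ^+ 2 * dotv (x t) (x t).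
      by rewrite !(dotvZl, dotvZr); ring.
    have := Hr _ _ y0; rewrite E => H; apply: le_trans (ler_norm _) (H _).
    apply: (@le_trans _ _ (4 * d * tau)); last first.
      by rewrite mulrAC mulrC -ler_pdivlMr // ge_min lexx orbT.
    have := xx t t01; have := dotv_ge0 (x t); have dd : d ^+ 2 <= d by rewrite expr2 ger_pMl.
    have := sqr_ge0 d; nra.
  apply: (le_trans h1); rewrite -[leRHS]mulrA ler_pM2l; last by rewrite divr_gt0.
  apply: (le_trans h2).
  have -> : (4 * tau ^+ 2)^-1 * (4 * d ^+ 2 * dotv (x t) (x t)) =
    d ^+ 2 / tau * (dotv (x t) (x t) / tau).
    by field; rewrite gt_eqF.
  rewrite ger_pMr; last by rewrite divr_gt0 // exprn_gt0.
  by rewrite ler_pdivrMr // mul1r; exact: xx.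
have cdx : continuous (fun t => d *: x t) := cont_Z (cont_cst d) cx.
have : ip tau (gradV (fun t => d *: x t)) (fun t => d *: x t) <=
  itg 0 tau (fun=> 2 / 3 * d ^+ 2 / tau).
  apply: itg_le; [|exact: cont_cst|exact: ltW|exact: bound].
  exact: dotv_cont (cont_comp cdx cG) cdx.
rewrite itg_cst subr0 divfK ?gt_eqF // subr_gt0 => h; apply: le_lt_trans h _.
have : 0 < d ^+ 2 by rewrite exprn_gt0.
lra.
Qed.

(** Since V'(y).y >= 2 V(y), [Ne (0, S)] is at most S^2 - 2 (S^2 - C) = 2 C - S^2, which is negative
    for S = 1 + 2 C. *)
Let stop : exists2 S, 1 <= S & Ne (0, S) < 0.
Proof.
have A0 : 0 <= (ip tau x x)^-1 by rewrite invr_ge0 ltW.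
have [C C0 HC] := pot_superquadratic tau0 cV Vsup cx A0.
exists (1 + 2 * C); first by rewrite lerDl mulr_ge0.
set S := 1 + 2 * C; have := HC S.
rewrite mulrAC mulVf ?gt_eqF // mul1r.
rewrite /Ne /en /gam /= subr0 expr1n expr0n /= !(mulr0, mul0r, mul1r, addr0).
rewrite (_ : (fun t => _ - _) = (fun t => S *: x t));
  last by apply/funext => t; rewrite scale0r subr0.
have cSx : continuous (fun t => S *: x t) := cont_Z (cont_cst S) cx.
have cVS : continuous (fun t => V (S *: x t)) := cont_comp cSx cV.
have : 2 * pot tau V (fun t => S *: x t) <=
  ip tau (gradV (fun t => S *: x t)) (fun t => S *: x t).
  rewrite /pot -(itgZ _ _ _ cVS); apply: itg_le.
  - exact: cont_M (cont_cst (2 : R)) cVS.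
  - exact: dotv_cont (cont_comp cSx cG) cSx.
  - exact: ltW.
  - by move=> t _; have := @Vray (S *: x t) 0 (lexx _); rewrite scale0r V_0 /gradV; lra.
rewrite /S; nra.
Qed.

(** [D s] is an energy bound for the gradient [G s], which vanishes at tau; once D s <= 0,
    [energy_holder] makes [G s] vanish on [0, tau]. *)
Lemma critical_ex : exists2 s, 0 < s &
  forall t, 0 <= t <= tau -> s *: x t = green tau (fun t => grad V (s *: x t)) t.
Proof.
have [d /andP[d0 d1] Nd] := start; have [S S1 NS] := stop.
have dS : d <= S := le_trans d1 S1.
have S0 : 0 <= S := le_trans ler01 S1.
have [C C0 HC] := D_small S0.
(* Choosing s as a minimum of D on [d, S] fixes it before e: any crossing r, whatever its dependence
   on e, gives D s <= D r <= C e. *)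
have [|s sdS Hs] := @EVT_min R D d S dS; first exact: continuous_subspaceT.
move: sdS; rewrite in_itv /= => /andP[ds sS]; have s0 := lt_le_trans d0 ds.
have near_e : \forall e \near (0 : R)^'+, D s <= C * e.
  have fixs (r : R) : continuous (fun e : R => Ne (e, r)) :=
    cont_comp (cont_pair cont_id (cont_cst r)) cNe.
  have n1 : \forall e \near (0 : R)^'+, 0 < Ne (e, d).
    by apply: cvg_within; apply: (@cvgr_gt _ _ _ _ _ _ (fixs d 0)).
  have n2 : \forall e \near (0 : R)^'+, Ne (e, S) < 0.
    by apply: cvg_within; apply: (@cvgr_lt _ _ _ _ _ _ (fixs S 0)).
  (* As the crossing depends on e, positivity of the energy bound is secured uniformly on [d, S]; at
     e = 0 it is r^2. *)
  have n3 : \forall e \near (0 : R), `[d, S] `<=` [set r | 0 < en (e, r)].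
    apply: ((compact_near_coveringP _).1 (@segment_compact R d S) R (nbhs (0 : R)) (fun e r
      => is_true (0 < en (e, r)))).
    move=> r; rewrite /= in_itv /= => /andP[dr _].
    have c : continuous (fun p : R * R => en (p.2, p.1)) :=
      cont_comp (cont_pair cont_snd cont_fst) cen.
    have := @cvgr_gt _ _ _ _ _ _ (c (r, 0)); apply.
    rewrite /en /= subr0 expr1n expr0n /= !(mulr0, mul0r, mul1r, addr0) exprn_gt0 //.
    exact: lt_le_trans dr.
  have n4 : \forall e \near (0 : R)^'+, `[d, S] `<=` [set r | 0 < en (e, r)] by exact:
    cvg_within.
  near=> e.
  have e0 : 0 < e by [].
  have e1 : e < 1 by near: e; exact: nbhs_right_lt.
  have Ned : 0 < Ne (e, d) by near: e.
  have NeS : Ne (e, S) < 0 by near: e.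
  have [r /andP[dr rS] Nr] : exists2 r, d <= r <= S & Ne (e, r) = 0.
    apply: seg_ivt dS _ (ltW Ned) (ltW NeS).
    exact: cont_comp (cont_pair (cont_cst e) cont_id) cNe.
  have enr : 0 < en (e, r).
    have h : `[d, S] `<=` [set r | 0 < en (e, r)] by near: e.
    by apply: h; rewrite /= in_itv /= dr.
  apply: (@le_trans _ _ (D r)); first by apply: Hs; rewrite in_itv /= dr.
  by apply: HC => //; rewrite ?e0 ?e1 // rS (lt_le_trans d0 dr).
have D0 : D s <= 0.
  apply/ler_addgt0Pl => e e0; rewrite addr0.
  have C1 : 0 < C + 1 by rewrite ltr_wpDl.
  have ec : 0 < e / (C + 1) by rewrite divr_gt0.
  have [q [q1 [q0 q2]]] : exists q : R, D s <= C * q /\ 0 < q /\ q < e / (C + 1).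
    have : \forall q \near (0 : R)^'+, D s <= C * q /\ 0 < q /\ q < e / (C + 1).
      near=> q; split; [by near: q|split=> //; near: q; exact: nbhs_right_lt].
    by move/filter_ex.
  move: q2; rewrite ltr_pdivlMr // => /ltW q2.
  apply: (le_trans q1); apply: le_trans q2.
  by rewrite mulrC ler_wpM2l ?(ltW q0) // lerDl.
have Es := energy_G s0; have Ds := energy_ge0 tau0 Es.
exists s => // t /andP[t0 tt].
have [_ Gtau _] := Es.
have := energy_holder Es t0 tt (lexx tau); rewrite Gtau subr0 => h.
have : G s t = 0.
  apply: dotv_eq0; apply/eqP; rewrite eq_le dotv_ge0 andbT; apply: le_trans h _.
  by rewrite mulr_le0_ge0 // subr_ge0.
by rewrite /G => /eqP; rewrite subr_eq0 => /eqP.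
Unshelve. all: by end_near. Qed.

End critical.

(** * Absence of interior zeros *)

Lemma green_eq (R : realType) (N : nat) (tau : R) (f g : R -> 'rV[R]_N) :
  continuous f -> continuous g -> (forall t, 0 <= t <= tau -> f t = g t) ->
  forall t, 0 <= t <= tau -> green tau f t = green tau g t.
Proof.
move=> cf cg fg t /andP[t0 tt]; apply/rowP => i; rewrite !mxE.
have cp h : continuous h -> continuous (fun r => vprim h r 0 i).
  by move=> ch; exact: (row_cont _).2 (vprim_cont ch) i.
apply: itg_eq => //; try exact: cp.
move=> r /andP[tr rt]; rewrite !mxE; apply: itg_eq.
- exact: (row_cont _).2 cf i.
- exact: (row_cont _).2 cg i.
- exact: le_trans tr.
- by move=> u /andP[u0 ur]; rewrite fg // u0 (le_trans ur).
Qed.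

Section groundstate.
Context {R : realType} {N : nat}.
Variables (tau : R) (V : 'rV[R]_N -> R).
Hypothesis tau0 : 0 < tau.
Hypothesis hC2 : is_C2 V.
Hypothesis V3 : forall y, y != 0 ->
  0 < dotv (grad V y) y /\ dotv (grad V y) y <= dotv (mxapp (hessian V y) y) y.
Hypothesis V4 : forall y, V y = V (- y).
Hypothesis hN : (1 <= N)%N.
Hypothesis V1 : V x / enorm x ^+ 2 @[x --> (0 : 'rV[R]_N)^'] --> (0 : R).
Hypothesis V2 : cvg_pinfty_at_infty (fun x : 'rV[R]_N => V x / enorm x ^+ 2).

Let cV : continuous V := V_cont hC2.
Let cG : continuous (grad V) := grad_cont hC2.
Let Vge0 : forall y, 0 <= V y := V_ge0 hC2 V3 V4 hN V1.
Let V0 : V 0 = 0 := V_0 hC2 hN V1.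

(* Conservation of energy replaces uniqueness for the Cauchy problem: a
   solution with zero position and velocity at one time vanishes. *)
Lemma green_energy0 (f : R -> 'rV[R]_N) (t1 : R) : continuous f ->
  (forall t, 0 <= t <= tau -> f t = grad V (green tau f t)) ->
  0 <= t1 <= tau -> green tau f t1 = 0 -> vprim f t1 = 0 ->
  forall t, 0 <= t <= tau -> green tau f t = 0.
Proof.
move=> cf hf t1t Z1 p1 t tt.
pose E (u : R) := dotv (vprim f u) (vprim f u) + 2 * V (green tau f u).
have dE (u : R) := is_deriveD (dotv_derive (@vprim_der _ _ f u cf) (@vprim_der _ _ f u cf))
  (is_deriveZ 2 (V_along hC2 (@green_der _ _ tau f u cf))).
have E0 u v : 0 <= u <= tau -> 0 <= v <= tau -> u <= v -> E v = E u.
  move=> /andP[u0 _] /andP[_ vt] uv.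
  apply: (is_derive_eq0 uv (fun t _ => dE t)) => r /andP[ur rv].
  rewrite -hf ?(le_trans u0 ur) ?(le_trans rv vt) // dotvNr /GRing.scale /=.
  by rewrite (dotvC (vprim f r)); ring.
have Et1 : E t1 = 0 by rewrite /E Z1 p1 dotv0 V0 mulr0 addr0.
have Et : E t = 0.
  by rewrite -Et1; have [h|/ltW h] := leP t t1; [apply/esym|]; exact: E0.
apply: (V_eq0 hC2 V3 V4 hN V1).
by move: Et; rewrite /E; have := dotv_ge0 (vprim f t); have := Vge0 (green tau f t); lra.
Qed.

(** At the midpoint of an interval of zeros the velocity vanishes too, so the energy is zero. *)
Lemma green_vanish (f : R -> 'rV[R]_N) (b c : R) : continuous f ->
  (forall t, 0 <= t <= tau -> f t = grad V (green tau f t)) ->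
  0 <= b -> b < c -> c <= tau -> (forall t, b < t < c -> green tau f t = 0) ->
  forall t, 0 <= t <= tau -> green tau f t = 0.
Proof.
move=> cf hf b0 bc ct Zbc.
pose m := (b + c) / 2.
have bm : b < m by rewrite /m; lra.
have mc : m < c by rewrite /m; lra.
apply: (@green_energy0 f m) => //.
- by rewrite (le_trans b0 (ltW bm)) (le_trans (ltW mc) ct).
- by rewrite Zbc // bm.
apply/rowP => i; have d1 := @green_der _ _ tau f m cf i.
have d2 : is_derive m 1 (fun u : R => green tau f u 0 i) 0.
  apply: (@near_eq_is_derive _ _ _ (cst 0)) => //.
    near=> u; rewrite Zbc ?mxE //.
    by apply/andP; split; near: u; [exact: lt_nbhsr|exact: lt_nbhsl].
have e1 := @derive_val _ _ _ _ _ _ _ d1; have e2 := @derive_val _ _ _ _ _ _ _ d2.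
have : (- vprim f m) 0 i = 0 by rewrite -e1 -e2.
by rewrite !mxE => /eqP; rewrite oppr_eq0 => /eqP.
Unshelve. all: by end_near. Qed.

Variables (c0 : R).
Hypothesis min0 : forall (y : R -> 'rV[R]_N) c, energy_le tau y 1 -> fiber_le tau V y c ->
  c0 <= c.

Let critical (x : R -> 'rV[R]_N) : energy_le tau x 1 -> fiber_le tau V x c0 ->
  0 < ip tau x x -> exists2 s, 0 < s &
  forall t, 0 <= t <= tau -> s *: x t = green tau (fun t => grad V (s *: x t)) t.
Proof.
move=> Ex xc x0.
exact: (critical_ex tau0 cV cG Vge0 V0 (@V_ray _ _ _ hC2 V3 V4) (V_small V1)
  (@V_superquadratic _ _ _ hC2 V3 V4 hN V1 V2) (@V_taylor _ _ _ hC2) min0 Ex xc x0).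
Qed.

Let ip_eq0 (x : R -> 'rV[R]_N) : continuous x ->
  (forall t, 0 <= t <= tau -> x t = 0) -> ip tau x x = 0.
Proof.
move=> cx z; rewrite /ip (itg_eq (dotv_cont cx cx) (cont_cst (0 : R)) (ltW tau0)).
  by rewrite itg_cst mul0r.
by move=> t /z ->; rewrite dotv0.
Qed.

(** Cutting at a zero does not raise the action: V <= V'(x).x / 2 makes the contribution of [a, tau]
    nonnegative. Hence e / 2 - [pot] y is at most half of <h, K h> minus [pot] (s x). Testing the
    energy bound of s x with h gives <h, K h> <= s^2, so this is at most c0. The truncation stays a
    Nehari point, and [nehari_le] extends the bound to its ray. *)
Lemma truncation_min (x : R -> 'rV[R]_N) (s a : R) :
  energy_le tau x 1 -> fiber_le tau V x c0 -> 0 < s ->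
  let h := fun t => grad V (s *: x t) in
  (forall t, 0 <= t <= tau -> s *: x t = green tau h t) ->
  0 < a -> a <= tau -> green tau h a = 0 ->
  let y := fun t => green tau h (Num.min t a) in
  let e := ip a h (green tau h) in
  0 < e ->
  energy_le tau (fun t => (Num.sqrt e)^-1 *: y t) 1 /\
  fiber_le tau V (fun t => (Num.sqrt e)^-1 *: y t) c0.
Proof.
move=> Ex xc s0 h xh a0 at_ Za y e e0.
have [cx xtau _] := Ex.
have csx : continuous (fun t => s *: x t) := cont_Z (cont_cst s) cx.
have ch : continuous h := cont_comp csx cG.
have cZ : continuous (green tau h) := green_cont ch.
have hE t : 0 <= t <= tau -> h t = grad V (green tau h t).
  by move=> /xh <-.
have a1 : 0 <= a <= tau by rewrite ltW.
have Ey : energy_le tau y e := energy_trunc ch a1 Za.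
have [cy ytau _] := Ey.
have yl t : 0 <= t <= a -> y t = green tau h t by move=> /andP[_ ta]; rewrite /y min_l.
have yr t : a <= t <= tau -> y t = 0 by move=> /andP[at' _]; rewrite /y min_r.
have split (Phi : 'rV[R]_N -> R) : continuous Phi -> Phi 0 = 0 ->
    itg 0 tau (fun t => Phi (y t)) = itg 0 a (fun t => Phi (green tau h t)).
  move=> cPhi P0; have cPy := cont_comp cy cPhi; have cPZ := cont_comp cZ cPhi.
  rewrite (itg_cat a) (itg_eq cPy cPZ (ltW a0)); last by move=> t /yl ->.
  rewrite (itg_eq cPy (cont_cst 0) at_); last by move=> t /yr ->.
  by rewrite itg_cst mul0r addr0.
have cdG : continuous (fun v : 'rV[R]_N => dotv (grad V v) v) := dotv_cont cG cont_id.
have chZ : continuous (fun t => dotv (h t) (green tau h t)) := dotv_cont ch cZ.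
have eqe b : 0 <= b -> b <= tau ->
  itg 0 b (fun t => dotv (grad V (green tau h t)) (green tau h t)) = ip b h (green tau h).
  move=> b0 bt; apply: (itg_eq (cont_comp cZ cdG) chZ b0) => t /andP[t0 tb].
  by rewrite hE // t0 (le_trans tb bt).
have Ne : ip tau (fun t => grad V (y t)) y = e.
  have := split (fun v => dotv (grad V v) v) cdG (dotv0 (grad V 0)).
  by rewrite (eqe a (ltW a0) at_).
have [E1 F1] := nehari_le tau0 cV cG (@V_ray _ _ _ hC2 V3 V4) Ey e0 Ne.
split=> // r r0; apply: le_trans (F1 r r0) _.
have potyE : pot tau V y = itg 0 a (fun t => V (green tau h t)) by exact: split.
have potxE : pot tau V (fun t => s *: x t) = itg 0 tau (fun t => V (green tau h t)).
  exact: (pot_eq tau0 cV csx cZ xh).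
have cVZ : continuous (fun t => V (green tau h t)) := cont_comp cZ cV.
have tail : itg a tau (fun t => V (green tau h t)) <=
  2^-1 * itg a tau (fun t => dotv (h t) (green tau h t)).
  rewrite -(itgZ _ _ _ chZ);
    apply: (itg_le cVZ (cont_M (cont_cst _) chZ) at_) => t /andP[at' tt].
  rewrite hE; last by rewrite (le_trans (ltW a0) at').
  exact: (V_le_grad hC2 V3 V4 hN V1).
have Es := energyZ (lt0r_neq0 s0) Ex; rewrite mulr1 in Es.
have ipxE : ip tau h (fun t => s *: x t) = ip tau h (green tau h).
  apply: (itg_eq (dotv_cont ch csx) chZ (ltW tau0)) => t /xh E.
  by rewrite [in LHS]E.
have es := energy_ip tau0 Es ch; rewrite ipxE in es.
have := xc s (ltW s0); rewrite potyE potxE.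
rewrite (itg_cat a 0 tau) /e.
move: es; rewrite /ip (itg_cat a 0 tau (fun t => dotv (h t) (green tau h t))).
lra.
Qed.

Lemma groundstate_neq0 (x : R -> 'rV[R]_N) (s : R) :
  energy_le tau x 1 -> fiber_le tau V x c0 -> 0 < ip tau x x -> 0 < s ->
  (forall t, 0 <= t <= tau -> s *: x t = green tau (fun t => grad V (s *: x t)) t) ->
  forall a, 0 <= a -> a < tau -> s *: x a != 0.
Proof.
move=> Ex xc x0 s0; set h := (fun t => grad V _) => xh a a0 at_; apply/negP => /eqP xa.
have [cx _ _] := Ex.
have csx : continuous (fun t => s *: x t) := cont_Z (cont_cst s) cx.
have ch : continuous h := cont_comp csx cG.
have cZ : continuous (green tau h) := green_cont ch.
have hE t : 0 <= t <= tau -> h t = grad V (green tau h t) by move=> /xh <-.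
have tt0 : 0 <= (0 : R) <= tau by rewrite lexx ltW.
have contra : ~ (forall t, 0 <= t <= tau -> green tau h t = 0).
  move=> Z0; move: x0; rewrite ip_eq0 ?ltxx // => t tt.
  by have := xh t tt; rewrite Z0 // => /eqP; rewrite scaler_eq0 gt_eqF //= => /eqP.
have Za : green tau h a = 0 by rewrite -xh ?xa // a0 ltW.
(* At a = 0 there is nothing to truncate, but the velocity there is zero by construction of [green],
   so conservation of energy applies directly. *)
move: a0; rewrite le_eqVlt => /predU1P[a0|a0].
  by apply: contra; apply: (green_energy0 ch hE tt0); rewrite ?vprim0 // a0.
have chZ : continuous (fun t => dotv (h t) (green tau h t)) := dotv_cont ch cZ.
have hZ t : 0 <= t <= a -> 0 <= dotv (h t) (green tau h t).
  move=> /andP[t0 ta]; rewrite hE ?t0 ?(le_trans ta (ltW at_)) //.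
  exact: dotv_grad_ge0.
(* Otherwise V'(x).x would vanish on (0, a), and x with it by the strict inequality in (V3). *)
have e0 : 0 < ip a h (green tau h).
  rewrite lt_neqAle itg_ge0 ?(ltW a0) // andbT; apply/negP => /eqP/esym I0.
  apply: contra; apply: (green_vanish ch hE (lexx 0) a0 (ltW at_)) => t ta.
  have := itg_eq0_ge0 chZ hZ I0 ta; have /andP[t0 ta'] := ta.
  rewrite hE ?(ltW t0) ?(le_trans (ltW ta') (ltW at_)) // => g0.
  by apply/eqP; apply: contra_eqT g0 => /V3[/gt_eqF -> _].
have [Ew Fw] := truncation_min Ex xc s0 xh a0 (ltW at_) Za e0.
pose k := (Num.sqrt (ip a h (green tau h)))^-1; pose y t := green tau h (Num.min t a).
have {}Ew : energy_le tau (fun t => k *: y t) 1 := Ew.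
have {}Fw : fiber_le tau V (fun t => k *: y t) c0 := Fw.
have k0 : 0 < k by rewrite invr_gt0 sqrtr_gt0.
have w0 : 0 < ip tau (fun t => k *: y t) (fun t => k *: y t).
  have [t [/andP[t0 ta] Zt]] : exists t, 0 <= t <= a /\ green tau h t != 0.
    apply: contrapT => H; apply: contra.
    apply: (green_vanish ch hE (lexx 0) a0 (ltW at_)) => t /andP[t0 ta].
    by apply/eqP/negPn/negP => Zt; apply: H; exists t; rewrite !ltW.
  apply: (energy_ip_gt0 tau0 Ew (t := t)); first by rewrite t0 (le_trans ta (ltW at_)).
  by rewrite scaler_eq0 negb_or gt_eqF //= /y min_l.
have [r r0 hr] := critical Ew Fw w0.
pose f t := grad V (r *: (k *: y t)).
have {}hr t : 0 <= t <= tau -> r *: (k *: y t) = green tau f t := hr t.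
have [cw _ _] := Ew.
have crw : continuous (fun t => r *: (k *: y t)) := cont_Z (cont_cst r) cw.
have cf : continuous f := cont_comp crw cG.
have fE t : 0 <= t <= tau -> f t = grad V (green tau f t) by move=> /hr <-.
have f0 : forall t, 0 <= t <= tau -> green tau f t = 0.
  apply: (green_vanish cf fE (ltW a0) at_ (lexx tau)) => t /andP[at' tt].
  rewrite -hr; last by rewrite (ltW tt) (le_trans (ltW a0) (ltW at')).
  by rewrite /y min_r ?(ltW at') // Za !scaler0.
have w_eq0 t : 0 <= t <= tau -> k *: y t = 0.
  move=> tt; have := hr t tt; rewrite (f0 t tt) => /eqP.
  by rewrite scaler_eq0 (gt_eqF r0) => /eqP.
by have := ip_eq0 cw w_eq0; apply/eqP; rewrite gt_eqF.
Qed.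

End groundstate.

(** * The solution on a quarter of the period *)

Lemma quarter_solution (R : realType) (N : nat) (tau : R) (V : 'rV[R]_N -> R) :
  0 < tau -> (1 <= N)%N -> is_C2 V ->
  V x / enorm x ^+ 2 @[x --> (0 : 'rV[R]_N)^'] --> (0 : R) ->
  cvg_pinfty_at_infty (fun x : 'rV[R]_N => V x / enorm x ^+ 2) ->
  (forall x : 'rV[R]_N, x != 0 -> 0 < dotv (grad V x) x /\
     dotv (grad V x) x <= dotv (mxapp (hessian V x) x) x) ->
  (forall x : 'rV[R]_N, V x = V (- x)) ->
  exists x : R -> 'rV[R]_N, [/\ continuous x,
    forall t, 0 <= t <= tau -> x t = green tau (fun t => grad V (x t)) t
    & forall t, 0 <= t -> t < tau -> x t != 0].
Proof.
move=> tau0 hN hC2 V1 V2 V3 V4.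
have cV := V_cont hC2; have V0 := V_0 hC2 hN V1.
have [c0 [x [Ex xc x0 min0]]] := minimizer_ex tau0 cV
  (@V_superquadratic _ _ _ hC2 V3 V4 hN V1 V2) V0 hN.
have [s s0 hs] := critical_ex tau0 cV (grad_cont hC2) (V_ge0 hC2 V3 V4 hN V1) V0
  (@V_ray _ _ _ hC2 V3 V4) (V_small V1) (@V_superquadratic _ _ _ hC2 V3 V4 hN V1 V2)
  (@V_taylor _ _ _ hC2) min0 Ex xc x0.
have [cx _ _] := Ex.
exists (fun t => s *: x t); split=> //; first exact: cont_Z (cont_cst s) cx.
exact: (groundstate_neq0 tau0 hC2 V3 V4 hN V1 V2 min0 Ex xc x0 s0 hs).
Qed.

(** * Extension by symmetry *)

Lemma vder_derive1 (R : realType) (N : nat) (x : R -> 'rV[R]_N) (dx : 'rV[R]_N) (t : R) :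
  vder x dx t -> derivable x t 1 /\ derive1 x t = dx.
Proof.
move=> hx; have ddx : derivable x t 1.
  by apply/derivable_mxP => i j; rewrite ord1; exact: (@ex_derive _ _ _ _ _ _ _ (hx j)).
split=> //; rewrite derive1E derive_mx //; apply/rowP => j; rewrite mxE.
exact: (@derive_val _ _ _ _ _ _ _ (hx j)).
Qed.

Lemma vder_inj (R : realType) (N : nat) (x y d : R -> 'rV[R]_N) (a : R) :
  (forall t, vder x (d t) t) -> (forall t, vder y (d t) t) -> x a = y a -> x = y.
Proof.
move=> dx dy xy; apply/funext => t; apply/rowP => i.
have := is_derive_inj (a := a) (fun t => dx t i) (fun t => dy t i) _.
by rewrite xy => /(_ erefl) /(congr1 (@^~ t)).
Qed.

Lemma vder_reflect (R : realType) (N : nat) (x : R -> 'rV[R]_N) (dx : 'rV[R]_N) (c t : R) :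
  vder x dx (c - t) -> vder (fun u => x (c - u)) (- dx) t.
Proof.
move=> hx i; have hxi := hx i.
have d1 : is_derive t 1 (fun u : R => c - u) (-1).
  have := is_deriveB (is_derive_cst c t 1) (is_derive_id t (1 : R)); rewrite sub0r; exact.
have := @is_derive1_comp R (fun u => x u 0 i) (fun u => c - u) t (dx 0 i) (-1) hxi d1.
by rewrite mulrN1 mxE.
Qed.

Lemma vderN (R : realType) (N : nat) (x : R -> 'rV[R]_N) (dx : 'rV[R]_N) (t : R) :
  vder x dx t -> vder (fun u => - x u) (- dx) t.
Proof.
move=> hx i; rewrite mxE (_ : (fun u => _) = - (fun u : R => x u 0 i)).
  exact: is_deriveN (hx i).
by apply/funext => u; rewrite mxE.
Qed.

Section green_symmetry.
Context {R : realType} {N : nat}.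
Variables (tau : R) (f : R -> 'rV[R]_N).
Hypothesis cf : continuous f.
Hypothesis f_even : forall t, f (- t) = f t.
Hypothesis f_odd : forall t, f (2 * tau - t) = - f t.

Let dp t : vder (vprim f) (f t) t := @vprim_der _ _ f t cf.
Let dK t : vder (green tau f) (- vprim f t) t := @green_der _ _ tau f t cf.

(** Both symmetries follow from uniqueness of antiderivatives, applied to [vprim f] and then to
    [green tau f]: the two sides have the same derivative and agree at the centre of reflection.
    Where this agreement is not automatic, it is [vprim f 0 = 0] for the centre 0 and
    [green tau f tau = 0] for the centre tau. *)
Lemma green_even t : green tau f (- t) = green tau f t.
Proof.
have pN : (fun u => vprim f (0 - u)) = (fun u => - vprim f u).
  apply: (vder_inj (d := fun u => - f u) (a := 0)) => [u|u|].
  - by rewrite -(f_even u) -[X in f X]sub0r; apply: vder_reflect; exact: dp.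
  - by apply: vderN; exact: dp.
  - by rewrite subr0 vprim0 oppr0.
have KN : (fun u => green tau f (0 - u)) = green tau f.
  apply: (vder_inj (d := fun u => - vprim f u) (a := 0)) => [u|u|]; last by rewrite subr0.
  - rewrite (_ : - vprim f u = - - vprim f (0 - u)).
      by apply: vder_reflect; exact: dK.
    by rewrite opprK -(congr1 (@^~ u) pN).
  - exact: dK.
by rewrite -[in RHS]KN sub0r.
Qed.

Lemma green_odd t : green tau f (2 * tau - t) = - green tau f t.
Proof.
have tt : 2 * tau - tau = tau by ring.
have pN : (fun u => vprim f (2 * tau - u)) = vprim f.
  apply: (vder_inj (d := f) (a := tau)) => [u|u|]; last by rewrite tt.
  - by rewrite -[f u]opprK -f_odd; apply: vder_reflect; exact: dp.
  - exact: dp.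
have KN : (fun u => green tau f (2 * tau - u)) = (fun u => - green tau f u).
  apply: (vder_inj (d := vprim f) (a := tau)) => [u|u|].
  - rewrite -(congr1 (@^~ u) pN) /= -[vprim f _]opprK.
    by apply: vder_reflect; exact: dK.
  - by rewrite -[vprim f u]opprK; apply: vderN; exact: dK.
  - by rewrite tt green_tau oppr0.
exact: (congr1 (@^~ t) KN).
Qed.

End green_symmetry.

Section fold.
Context {R : realType}.
Variable tau : R.
Hypothesis tau0 : 0 < tau.

(* The distance from t to the lattice 4 tau Z. *)
Definition fold (t : R) : R :=
  `|t - (Num.floor (t / (4 * tau) + 2^-1))%:~R * (4 * tau)|.

Lemma fold_lattice t : exists k : int, `|t - k%:~R * (4 * tau)| = fold t.
Proof. by exists (Num.floor (t / (4 * tau) + 2^-1)). Qed.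

Lemma fold_le t : fold t <= 2 * tau.
Proof.
have t4 : 0 < 4 * tau by rewrite mulr_gt0.
rewrite /fold; set k := Num.floor _.
have h1 : k%:~R <= t / (4 * tau) + 2^-1 := Num.Theory.floor_le_tmp _.
have h2 : t / (4 * tau) + 2^-1 < (k + 1)%:~R := Num.Theory.floorD1_gt _.
rewrite rmorphD /= in h2.
have E : t = t / (4 * tau) * (4 * tau) by rewrite divfK // gt_eqF.
rewrite ler_norml {1}E [X in _ && (X - _ <= _)]E; set q := t / _ in h1 h2 *.
by apply/andP; split; nra.
Qed.

Lemma fold_ge0 t : 0 <= fold t. Proof. exact: normr_ge0. Qed.

Lemma normr_intz_ge1 (k : int) : k != 0 -> (1 : R) <= `|k%:~R|.
Proof. by move=> k0; rewrite -intr_norm -[1]/(1%:~R) ler_int -gtz0_ge1 normr_gt0. Qed.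

(** Lattice points are at least 4 tau apart, so two of them within 2 tau of t are both at distance
    exactly 2 tau. *)
Lemma fold_uniq t r (k : int) : r <= 2 * tau -> `|t - k%:~R * (4 * tau)| = r -> fold t = r.
Proof.
move=> r2 rE; have [m mE] := fold_lattice t; have m2 := fold_le t.
have [km|km] := eqVneq k m; first by rewrite -mE -km.
have t4 : 0 < 4 * tau by rewrite mulr_gt0.
have h : 4 * tau <= `|(t - k%:~R * (4 * tau)) - (t - m%:~R * (4 * tau))|.
  rewrite (_ : _ - _ = (m - k)%:~R * (4 * tau)); last by rewrite rmorphB /=; ring.
  rewrite normrM (gtr0_norm t4) ler_peMl ?(ltW t4) //.
  by apply: normr_intz_ge1; rewrite subr_eq0 eq_sym.
have := ler_normB (t - k%:~R * (4 * tau)) (t - m%:~R * (4 * tau)).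
rewrite rE mE; lra.
Qed.

Lemma fold_id t : 0 <= t <= 2 * tau -> fold t = t.
Proof.
by move=> /andP[t0 t2]; apply: (fold_uniq (k := 0)) => //; rewrite mul0r subr0 ger0_norm.
Qed.

Lemma foldN t : fold (- t) = fold t.
Proof.
have [k kE] := fold_lattice t; apply: (fold_uniq (k := - k)) (fold_le t) _.
by rewrite -kE rmorphN /= -[RHS]normrN; congr `|_|; ring.
Qed.

Lemma fold_half t : fold (t + 2 * tau) = 2 * tau - fold t.
Proof.
have [k kE] := fold_lattice t; have f2 := fold_le t; have f0 := fold_ge0 t.
move: kE; case: (ger0P (t - k%:~R * (4 * tau))) => _ kE.
  apply: (fold_uniq (k := k + 1)); first by rewrite gerBl.
  rewrite rmorphD /= -kE -normrN ger0_norm; last first.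
    by rewrite -kE in f2; rewrite opprB; lra.
  by rewrite opprB; ring.
apply: (fold_uniq (k := k)); first by rewrite gerBl.
rewrite -kE ger0_norm; last by rewrite -kE in f2; lra.
ring.
Qed.

Lemma fold_cont : continuous fold.
Proof.
have lip s t : fold s <= `|s - t| + fold t.
  have [k kE] := fold_lattice t; have [s2|s2] := leP `|s - k%:~R * (4 * tau)| (2 * tau).
    rewrite (fold_uniq s2 erefl) -kE.
    rewrite (_ : s - k%:~R * (4 * tau) = (s - t) + (t - k%:~R * (4 * tau))); last by ring.
    exact: ler_normD.
  apply: (le_trans (fold_le s)); apply: (le_trans (ltW s2)); rewrite -kE.
  rewrite (_ : s - k%:~R * (4 * tau) = (s - t) + (t - k%:~R * (4 * tau))); last by ring.
  exact: ler_normD.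
move=> t; apply/cvgrPdist_lt => e e0.
have := (@cont_id R t : (fun s => s) @ t --> t) => /cvgrPdist_lt /(_ _ e0).
apply: filterS => s ts; apply: le_lt_trans ts.
rewrite ler_norml; have := lip s t; have := lip t s; rewrite (distrC s t).
by move=> h1 h2; apply/andP; split; lra.
Qed.

End fold.

Section extension.
Context {R : realType} {N : nat}.
Variables (tau : R) (x : R -> 'rV[R]_N).
Hypothesis tau0 : 0 < tau.
Hypothesis cx : continuous x.
Hypothesis xtau : x tau = 0.

(* Since x tau = 0, this is x (fold t) when fold t <= tau and
   - x (2 tau - fold t) otherwise. *)
Definition ext (t : R) : 'rV[R]_N :=
  x (Num.min (fold tau t) tau) - x (2 * tau - Num.max (fold tau t) tau).

Lemma ext_cont : continuous ext.
Proof.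
have cw := fold_cont tau0.
apply: cont_B; apply: (cont_comp _ cx).
  move=> t; exact: (@continuous_min _ _ (fold tau) (cst tau) t (cw t) (@cont_cst R R tau t)).
apply: cont_B; first exact: cont_cst.
move=> t; exact: (@continuous_max _ _ (fold tau) (cst tau) t (cw t) (@cont_cst R R tau t)).
Qed.

Lemma ext_even t : ext (- t) = ext t.
Proof. by rewrite /ext foldN. Qed.

Lemma ext_half t : ext (t + 2 * tau) = - ext t.
Proof.
rewrite /ext fold_half // opprB; set w := fold tau t.
have -> : Num.min (2 * tau - w) tau = 2 * tau - Num.max w tau.
  by have [] := leP w tau; have [] := leP (2 * tau - w) tau; lra.
have -> // : 2 * tau - Num.max (2 * tau - w) tau = Num.min w tau.
by have [] := leP w tau; have [] := leP (2 * tau - w) tau; lra.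
Qed.

Lemma ext_id t : 0 <= t <= tau -> ext t = x t.
Proof.
move=> /andP[t0 tt]; rewrite /ext fold_id ?t0 //=; last by lra.
by rewrite min_l // max_r // (_ : 2 * tau - tau = tau) ?xtau ?subr0 //; ring.
Qed.

Lemma ext_zero t : (forall s, 0 <= s -> s < tau -> x s != 0) -> ext t = 0 -> fold tau t = tau.
Proof.
move=> xn0; rewrite /ext; set w := fold tau t => E.
have w0 : 0 <= w := fold_ge0 tau t; have w2 : w <= 2 * tau := fold_le tau0 t.
have E2 : 2 * tau - tau = tau by ring.
have [wt|wt|//] := ltgtP w tau.
  move: E; rewrite (min_l (ltW wt)) (max_r (ltW wt)) E2 xtau subr0 => /eqP.
  by rewrite (negbTE (xn0 _ w0 wt)).
move: E; rewrite (min_r (ltW wt)) (max_l (ltW wt)) xtau sub0r => /eqP.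
by rewrite oppr_eq0 (negbTE (xn0 _ _ _)) //; lra.
Qed.

End extension.

Lemma int_periodic (R : realType) (U : zmodType) (f : R -> U) (T : R) (k : int) (t : R) :
  (forall u, f (u + T) = f u) -> f (t - k%:~R * T) = f t.
Proof.
move=> fT; have fn (n : nat) u : f (u + n%:R * T) = f u.
  elim: n u => [|n IH] u; first by rewrite mul0r addr0.
  by rewrite -natr1 mulrDl mul1r addrA fT.
case: (intP k) => [|n|n]; first by rewrite mul0r subr0.
  by rewrite -(fn n.+1) subrK.
by rewrite rmorphN /= mulNr opprK fn.
Qed.

(** Evenness about 0 and oddness about tau give period 4 tau, so each t reduces to [fold tau t] in
    [0, 2 tau], and then by oddness to [0, tau]. *)
Lemma symmetric_eq (R : realType) (N : nat) (tau : R) (f g : R -> 'rV[R]_N) : 0 < tau ->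
  (forall t, f (- t) = f t) -> (forall t, g (- t) = g t) ->
  (forall t, f (2 * tau - t) = - f t) -> (forall t, g (2 * tau - t) = - g t) ->
  (forall t, 0 <= t <= tau -> f t = g t) -> f = g.
Proof.
move=> tau0 fe ge fo go fg.
have per (h : R -> 'rV[R]_N) : (forall t, h (- t) = h t) ->
  (forall t, h (2 * tau - t) = - h t) ->
    forall u, h (u + 4 * tau) = h u.
  move=> he ho u; rewrite (_ : u + 4 * tau = 2 * tau - (- u - 2 * tau)); last by ring.
  by rewrite ho (_ : - u - 2 * tau = - (2 * tau - (- u))) ?he ?ho ?he ?opprK //; ring.
have fold_eq (h : R -> 'rV[R]_N) : (forall t, h (- t) = h t) ->
  (forall t, h (2 * tau - t) = - h t) ->
    forall u, h u = h (fold tau u).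
  move=> he ho u; rewrite /fold; set k := Num.floor _.
  rewrite -(int_periodic k u (per h he ho)).
  by have [_|_] := ger0P (u - k%:~R * (4 * tau)); rewrite ?he.
apply/funext => t; rewrite (fold_eq f fe fo) (fold_eq g ge go).
set w := fold tau t; have w0 : 0 <= w := fold_ge0 tau t; have w2 : w <= 2 * tau :=
  fold_le tau0 t.
have [wt|wt] := leP w tau; first by rewrite fg // w0.
rewrite (_ : w = 2 * tau - (2 * tau - w)); last by ring.
by rewrite fo go fg //; apply/andP; split; lra.
Qed.

(** A period S moves the zero tau to the zero tau + S, so S is a multiple of 2 tau. Below 4 tau only
    2 tau is left, and there x changes sign while x 0 <> 0. *)
Lemma period_of_zeros (R : realType) (N : nat) (tau : R) (x : R -> 'rV[R]_N) :
  0 < tau -> (forall t, x (t + 2 * tau) = - x t) -> x 0 != 0 -> x tau = 0 ->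
  (forall t, x t = 0 -> fold tau t = tau) -> minimal_period x (4 * tau).
Proof.
move=> tau0 xh x0 xtau xz; split; first by rewrite mulr_gt0.
  by move=> u; rewrite (_ : u + 4 * tau = u + 2 * tau + 2 * tau) ?xh ?opprK //; ring.
move=> S S0 xS; rewrite leNgt; apply/negP => S4.
suff S2 : S = 2 * tau.
  have := xS 0; rewrite S2 xh => /eqP; rewrite -subr_eq0 -opprD oppr_eq0 -mulr2n -scaler_nat.
  by rewrite scaler_eq0 pnatr_eq0 (negbTE x0).
have := xz (tau + S); rewrite xS => /(_ xtau).
have [k <-] := fold_lattice tau (tau + S).
have t4 : 0 < 4 * tau by rewrite mulr_gt0.
(* The point tau + S is at distance tau from 4 k tau: either S = 4 k tau, impossible for 0 < S < 4
   tau, or S = (k - 1/2) 4 tau, which forces k = 1. *)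
have [k0 kE|k0 kE] := ger0P (tau + S - k%:~R * (4 * tau)).
  have E : S = k%:~R * (4 * tau) by lra.
  move: S0 S4; rewrite E pmulr_lgt0 // => k1; rewrite -[ltRHS]mul1r ltr_pM2r // => k2.
  by move: k1 k2; rewrite ltr0z -[1]/(1%:~R) ltr_int; lia.
have E : S = (k%:~R - 2^-1) * (4 * tau) by lra.
have k1 : 0 < k%:~R - 2^-1 :> R by move: S0; rewrite E pmulr_lgt0.
have k2 : k%:~R - 2^-1 < 1 :> R by move: S4; rewrite E -[ltRHS]mul1r ltr_pM2r.
have k3 : (0 : R) < k%:~R by lra.
have k4 : k%:~R < (2%:~R : R) by rewrite -[2%:~R]/(2 : R); lra.
have -> : S = (1%:~R - 2^-1) * (4 * tau).
  rewrite E; congr ((_%:~R - _) * _).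
  by move: k3 k4; rewrite ltr0z ltr_int; lia.
by rewrite -[1%:~R]/(1 : R); field.
Qed.

Theorem theorem1p1 (R : realType) (N : nat) (hN : (1 <= N)%N)
    (V : 'rV[R]_N -> R) (hC2 : is_C2 V)
    (V1 : V x / enorm x ^+ 2 @[x --> (0 : 'rV[R]_N)^'] --> (0 : R))
    (V2 : cvg_pinfty_at_infty (fun x : 'rV[R]_N => V x / enorm x ^+ 2))
    (V3 : forall x : 'rV[R]_N, x != 0 ->
       0 < dotv (grad V x) x /\
       dotv (grad V x) x <= dotv (mxapp (hessian V x) x) x)
    (V4 : forall x : 'rV[R]_N, V x = V (- x)) :
  forall T : R, 0 < T ->
  exists x : R -> 'rV[R]_N,
    [/\ is_solution V x, minimal_period x T,
        even_about x 0 /\ even_about x (T / 2)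
      & odd_about x (T / 4) /\ odd_about x (3 * T / 4)].
Proof.
move=> T T0; pose tau := T / 4.
have tau0 : 0 < tau by rewrite divr_gt0.
have TE : T = 4 * tau by rewrite /tau; field.
have [x [cx xE xn0]] := quarter_solution tau0 hN hC2 V1 V2 V3 V4.
have xtau : x tau = 0 by rewrite xE ?green_tau // lexx ltW.
pose X := ext tau x; pose H t := grad V (X t).
have cH : continuous H := cont_comp (ext_cont tau0 cx) (grad_cont hC2).
have Xe t : X (- t) = X t := ext_even x tau0 t.
have Xh t : X (t + 2 * tau) = - X t := ext_half x tau0 t.
have Xx t : 0 <= t <= tau -> X t = x t := ext_id tau0 xtau (t := t).
have Xo t : X (2 * tau - t) = - X t by rewrite addrC Xh Xe.
have He t : H (- t) = H t by rewrite /H Xe.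
have Ho t : H (2 * tau - t) = - H t by rewrite /H Xo grad_odd.
(* Both sides share the symmetries and agree on [0, tau], hence everywhere. The second derivative of
   X on all of R is then read off from [green], with no matching of one-sided derivatives at the
   junctions. *)
have XE : X = green tau H.
  have Ge t : green tau H (- t) = green tau H t by exact: green_even.
  have Go t : green tau H (2 * tau - t) = - green tau H t by exact: green_odd.
  apply: (symmetric_eq tau0 Xe Ge Xo Go) => t tt.
  have cgx : continuous (fun u => grad V (x u)) := cont_comp cx (grad_cont hC2).
  rewrite (Xx t tt) (xE t tt); apply: (green_eq cgx cH _ tt) => u ut.
  by rewrite /H (Xx u ut).
exists X; split.
- move=> t; have [d1 _] := vder_derive1 (@green_der _ _ tau H t cH).
  have dE : derive1 (green tau H) = (fun u => - vprim H u).
    by apply/funext => u; have [] := vder_derive1 (@green_der _ _ tau H u cH).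
  have [d2 d2E] := vder_derive1 (vderN (@vprim_der _ _ H t cH)).
  rewrite XE dE; split=> //; rewrite d2E -XE; exact: addNr.
- rewrite TE; apply: period_of_zeros => //.
  + by rewrite Xx ?xn0 // lexx ltW.
  + by rewrite Xx // lexx ltW.
  + by move=> t; exact: (ext_zero tau0 xtau xn0).
- have T2 : T / 2 = 2 * tau by rewrite TE; field.
  split=> s; first by rewrite add0r sub0r Xe.
  by rewrite T2 Xo addrC Xh.
- have T4 : T / 4 = tau by [].
  have T34 : 3 * T / 4 = 3 * tau by rewrite TE; field.
  have o s : X (tau + s) = - X (tau - s).
    by rewrite -Xo; congr X; ring.
  split=> s; first by rewrite T4.
  have e1 : 3 * tau + s = tau + s + 2 * tau by ring.
  have e2 : 3 * tau - s = tau - s + 2 * tau by ring.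
  by rewrite T34 e1 e2 !Xh o.
Qed.
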